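(* The formal series $\Psi_j$, for $j\in\frac12\mathbb Z$, and $\Gamma$ are actually in $$\mathbb C[\mathcal A][\mathcal M][\mathcal B][\mathcal N][[\alpha_0^{-1/2}]],$$ i.e. they are power series in $\alpha_0^{-1/2}$ whose coefficients are polynomials in the $\mathcal A_j$'s, $\mathcal M_{j-1/2}$'s, $\mathcal B_j$'s and $\mathcal N_{j-1/2}$'s.
   Context: Here $\mathcal A=\{\mathcal A_j\}_{j\ge1}$, $\mathcal B=\{\mathcal B_j\}_{j\ge1}$ and $\alpha_0^{1/2}$ are even formal variables, $\mathcal M=\{\mathcal M_{j-1/2}\}_{j\ge1}$, $\mathcal N=\{\mathcal N_{j-1/2}\}_{j\ge1}$ odd formal variables (mutually anticommuting, square zero). $V[[\mathcal A,\mathcal B]][\mathcal M,\mathcal N]$ denotes all formal, possibly infinite, sums of monomials in these variables with coefficients in $V$. Definition of $\Psi_j$: let $x$ be even and $\varphi$ odd, $L_j(x,\varphi)=-(x^{j+1}\partial_x+\frac{j+1}2\varphi x^j\partial_\varphi)$, $G_{j-1/2}(x,\varphi)=-x^j(\partial_\varphi-\varphi\partial_x)$, and let $b^{\mp2L_0(x,\varphi)}$ send $c\varphi^mx^n$ to $c\,b^{\pm(2n+m)}\varphi^mx^n$. $\Psi_j\in\mathbb C[\alpha_0^{1/2},\alpha_0^{-1/2}][[\mathcal A,\mathcal B]][\mathcal M,\mathcal N]$, $j\in\frac12\mathbb Z$ (even for $j\in\mathbb Z$, odd otherwise), are the unique series without constant term such that $\bar F^{(1)}=\exp(\sum_{j\ge1}(\Psi_{-j}L_{-j}(x,\varphi)+\Psi_{-j+1/2}G_{-j+1/2}(x,\varphi)))\cdot(x,\varphi)$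 and $\bar F^{(2)}=\exp(-2\Psi_0L_0(x,\varphi))\cdot(\alpha_0^{1/2})^{2L_0(x,\varphi)}\cdot\exp(-\sum_{j\ge1}(\Psi_jL_j(x,\varphi)+\Psi_{j-1/2}G_{j-1/2}(x,\varphi)))\cdot(x,\varphi)$ satisfy $\bar F^{(1)}=\bar F^{(2)}\circ\bar K\circ\bar H$, where $\bar H=\exp(-\sum_{j\ge1}(\mathcal A_jL_j(x,\varphi)+\mathcal M_{j-1/2}G_{j-1/2}(x,\varphi)))\cdot(\alpha_0^{1/2})^{-2L_0(x,\varphi)}\cdot(x,\varphi)$ and $\bar K=\exp(-\sum_{j\ge1}(\mathcal B_jL_{-j}(x,\varphi)+\mathcal N_{j-1/2}G_{-j+1/2}(x,\varphi)))\cdot(x,\varphi)$ (operators act right to left). Definition of $\Gamma$: let $\mathfrak{ns}$ be the $N=1$ Neveu-Schwarz Lie superalgebra with basis $d$ (central), $L_n$ (even), $G_{n+1/2}$ (odd), $n\in\mathbb Z$, and $[L_m,L_n]=(m-n)L_{m+n}+\frac1{12}(m^3-m)\delta_{m+n,0}d$, $[G_{m+\frac12},L_n]=(m-\frac{n-1}2)G_{m+n+\frac12}$, $[G_{m+\frac12},G_{n-\frac12}]=2L_{m+n}+\frac13(m^2+m)\delta_{m+n,0}d$. Adjoin to its universal enveloping algebra even elements $P_n$, $n\in\frac12\mathbb Z$, with $P_iP_j=\delta_{i,j}P_i$, $P_iL_m=L_mP_{i+m}$, $P_iG_{m-\frac12}=G_{m-\frac12}P_{i+m-\frac12}$, $P_id=dP_i$,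 giving $U_P(\mathfrak{ns})$, and put $(\alpha_0^{1/2})^{-2L_0}=\sum_nP_n(\alpha_0^{1/2})^{-2n}$. $\Gamma\in(\mathbb C[\alpha_0^{1/2},\alpha_0^{-1/2}][[\mathcal A,\mathcal B]][\mathcal M,\mathcal N])^0$ is the unique even series without constant term such that, over $U_P(\mathfrak{ns})$, $$e^{-\sum_{j\ge1}(\mathcal A_jL_j+\mathcal M_{j-\frac12}G_{j-\frac12})}(\alpha_0^{1/2})^{-2L_0}e^{-\sum_{j\ge1}(\mathcal B_jL_{-j}+\mathcal N_{j-\frac12}G_{-j+\frac12})}=e^{\sum_{j\ge1}(\Psi_{-j}L_{-j}+\Psi_{-j+\frac12}G_{-j+\frac12})}e^{\sum_{j\ge1}(\Psi_jL_j+\Psi_{j-\frac12}G_{j-\frac12})}e^{2\Psi_0L_0}(\alpha_0^{1/2})^{-2L_0}e^{\Gamma d}.$$ *)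

(* Defs.v *)
From HB Require Import structures.
From mathcomp Require Import all_boot all_order all_algebra finmap.
From mathcomp Require Import boolp classical_sets functions cardinality.
From mathcomp Require Import fsbigop reals complex monalg.

Set Implicit Arguments.
Unset Strict Implicit.
Unset Printing Implicit Defensive.

Import Order.TTheory GRing.Theory Num.Theory.

Local Open Scope classical_set_scope.
Local Open Scope ring_scope.

(* The even variable (false, i) is A_{i+1} and (true, i) is B_{i+1};
   the odd variable (false, i) is M_{i+1/2} and (true, i) is N_{i+1/2}.
   The formal variable t below stands for alpha_0^{1/2}. *)
Definition evar : choiceType := (bool * nat)%type.
Definition ovar := (bool *l nat)%type.

(* (e, S) is the monomial A^e B^e times the product of the odd variables in S,
   taken in increasing order. *)
Definition monomial := ({cmonom evar} * {fset ovar})%type.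

Definition mon1 : monomial := (mone : {cmonom evar}, fset0).
Definition mon_even (v : evar) : monomial := (ucm v, fset0).
Definition mon_odd (v : ovar) : monomial := (mone : {cmonom evar}, [fset v]%fset).

Definition mon_parity (m : monomial) : bool := odd #|` m.2|.

(* [factors M] is the set of (m, m') with m m' = M or m m' = - M; the sign is
   (-1)^(number of inversions). *)
Definition factors (M : monomial) : set (monomial * monomial) :=
  [set p | [/\ M.1 = mmul p.1.1 p.2.1, M.2 = (p.1.2 `|` p.2.2)%fset
             & fdisjoint p.1.2 p.2.2]].

Definition inversions (m m' : monomial) : nat :=
  (\sum_(u <- m.2) \sum_(v <- m'.2) (v < u)%O)%N.

(* A superalgebra W with a distinguished homogeneous basis such that the
   product of two basis elements is a basis element or zero (None). *)
Record superbasis := SuperBasis {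
  sbasis :> choiceType;
  sb_one : sbasis;
  sb_mul : sbasis -> sbasis -> option sbasis;
  sb_parity : sbasis -> bool
}.

Section Series.
Context (K : fieldType).

(* K[t, t^-1] *)
Definition laurent := {malg K[int]}.

(* K[t, t^-1][[A, B]][M, N] *)
Definition scalars := monomial -> laurent.

(* W[t, t^-1], where (k, w) stands for t^k w *)
Definition coefs (W : superbasis) := {malg K[(int * W)%type]}.

(* W[t, t^-1][[A, B]][M, N], monomials being written to the left of the
   coefficients *)
Definition series (W : superbasis) := monomial -> coefs W.

(* Sum of a locally finite family of formal series. *)
Definition ssum (I : choiceType) (W : superbasis) (u : I -> series W) :
  series W := fun M => \sum_(i \in [set: I]) u i M.

Definition svar (m : monomial) : scalars :=
  fun M => if M == m then << (0 : int) >> else 0.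

Section Operations.
Context (W : superbasis).

Definition cmul (f g : coefs W) : coefs W :=
  \sum_(a <- msupp f) \sum_(b <- msupp g)
    if sb_mul a.2 b.2 is Some c then << f@_a * g@_b *g (a.1 + b.1, c) >> else 0.

(* (-1)^(s |f|) f *)
Definition ctwist (s : bool) (f : coefs W) : coefs W :=
  \sum_(a <- msupp f) << (-1) ^+ (s && sb_parity a.2) * f@_a *g a >>.

Definition tcoef (k : int) (f : coefs W) : {malg K[W]} :=
  \sum_(a <- msupp f | a.1 == k) << f@_a *g a.2 >>.

(* (m w) (m' w') = (-1)^(|w| |m'|) (m m') (w w') *)
Definition smul (f g : series W) : series W := fun M =>
  \sum_(p \in factors M) (-1) ^+ inversions p.1 p.2
    *: cmul (ctwist (mon_parity p.2) (f p.1)) (g p.2).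

Definition scst (k : int) (w : W) : series W :=
  fun M => if M == mon1 then << (k, w) >> else 0.

Definition sone : series W := scst 0 (sb_one W).

Definition lift (c : scalars) : series W :=
  fun M => \sum_(k <- msupp (c M)) << (c M)@_k *g (k, sb_one W) >>.

(* exp(D) f, for a linear operator D *)
Definition opexp (D : series W -> series W) (f : series W) : series W :=
  ssum (fun n : nat => (n`!%:R : K)^-1 *: iter n D f).

Definition sexp (u : series W) : series W := opexp (smul u) sone.

Definition sinv (h : series W) : series W :=
  xget 0 [set w | smul h w = sone].

Definition spow (h : series W) (n : int) : series W :=
  match n with
  | Posz k => iter k (smul h) sone
  | Negz k => iter k.+1 (smul (sinv h)) sone
  end.

End Operations.

Section Superfunctions.

(* (n, e) stands for phi^e x^n. *)
Definition xphi : superbasis := @SuperBasis (int * bool)%type (0, false)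
  (fun a b => if a.2 && b.2 then None else Some (a.1 + b.1, a.2 || b.2))
  (fun a => a.2).

Definition linext (g : int * xphi -> coefs xphi) (f : coefs xphi) :
  coefs xphi := \sum_(a <- msupp f) f@_a *: g a.

Definition ddx : coefs xphi -> coefs xphi :=
  linext (fun a => a.2.1%:~R *: << (a.1, (a.2.1 - 1, a.2.2)) >>).

Definition ddphi : coefs xphi -> coefs xphi :=
  linext (fun a => if a.2.2 then << (a.1, (a.2.1, false)) >> else 0).

Definition xpow (j : int) : coefs xphi := << (0, (j, false)) >>.
Definition phi : coefs xphi := << (0, (0, true)) >>.

(* L_j(x, phi) *)
Definition Lx (j : int) (f : coefs xphi) : coefs xphi :=
  - (cmul (xpow (j + 1)) (ddx f)
     + ((j + 1)%:~R / 2) *: cmul phi (cmul (xpow j) (ddphi f))).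

(* G_{j+1/2}(x, phi) *)
Definition Gx (j : int) (f : coefs xphi) : coefs xphi :=
  - cmul (xpow (j + 1)) (ddphi f - cmul phi (ddx f)).

(* t^{-2 s L_0(x, phi)} *)
Definition tpow (s : int) : coefs xphi -> coefs xphi :=
  linext (fun a => << (a.1 + s * (2 * a.2.1 + (a.2.2 : nat)%:Z), a.2) >>).

(* Action on series of an operator of parity s: P (m w) = (-1)^(s |m|) m P(w) *)
Definition act (s : bool) (P : coefs xphi -> coefs xphi) (f : series xphi) :
  series xphi := fun M => (-1) ^+ (s && mon_parity M) *: P (f M).

Definition actL (c : scalars) (j : int) (f : series xphi) : series xphi :=
  smul (lift xphi c) (act false (Lx j) f).
Definition actG (c : scalars) (j : int) (f : series xphi) : series xphi :=
  smul (lift xphi c) (act true (Gx j) f).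

(* With a i = a_{i+1} and b i = b_{i+1/2}:
   sum_{j >= 1} (a_j L_j(x, phi) + b_{j-1/2} G_{j-1/2}(x, phi)). *)
Definition vf_pos (a b : nat -> scalars) (f : series xphi) : series xphi :=
  ssum (fun i : nat => actL (a i) i.+1%:Z f + actG (b i) i%:Z f).
(* sum_{j >= 1} (a_j L_{-j}(x, phi) + b_{j-1/2} G_{-j+1/2}(x, phi)) *)
Definition vf_neg (a b : nat -> scalars) (f : series xphi) : series xphi :=
  ssum (fun i : nat => actL (a i) (- i.+1%:Z) f + actG (b i) (- i.+1%:Z) f).

(* T . (x, phi) *)
Definition at_xphi (T : series xphi -> series xphi) :
  series xphi * series xphi :=
  (T (scst 0 ((1, false) : xphi)), T (scst 0 ((0, true) : xphi))).

(* Substitution of h for (x, phi). *)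
Definition ceval (h : series xphi * series xphi) (f : coefs xphi) :
  series xphi :=
  \sum_(a <- msupp f) f@_a *:
    smul (scst a.1 (sb_one xphi))
         (smul (if a.2.2 then h.2 else sone xphi) (spow h.1 a.2.1)).

Definition scomp1 (f : series xphi) (h : series xphi * series xphi) :
  series xphi :=
  ssum (fun m : monomial => smul (lift xphi (svar m)) (ceval h (f m))).

Definition scomp (f h : series xphi * series xphi) :
  series xphi * series xphi := (scomp1 f.1 h, scomp1 f.2 h).

End Superfunctions.

Section Sewing.

Definition vA (i : nat) : scalars := svar (mon_even (false, i)).
Definition vB (i : nat) : scalars := svar (mon_even (true, i)).
Definition vM (i : nat) : scalars := svar (mon_odd (false, i)).
Definition vN (i : nat) : scalars := svar (mon_odd (true, i)).

(* [Psi p] is Psi_{p/2}. *)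
Section Halves.
Context (Psi : int -> scalars).
Definition even_pos (i : nat) : scalars := Psi (2 * i.+1%:Z).
Definition odd_pos (i : nat) : scalars := Psi (2 * i.+1%:Z - 1).
Definition even_neg (i : nat) : scalars := Psi (- (2 * i.+1%:Z)).
Definition odd_neg (i : nat) : scalars := Psi (- (2 * i.+1%:Z) + 1).
End Halves.

Definition Hbar : series xphi * series xphi :=
  at_xphi (fun f => opexp (fun g => - vf_pos vA vM g) (act false (tpow 1) f)).

Definition Kbar : series xphi * series xphi :=
  at_xphi (opexp (fun g => - vf_neg vB vN g)).

Definition F1bar (Psi : int -> scalars) : series xphi * series xphi :=
  at_xphi (opexp (vf_neg (even_neg Psi) (odd_neg Psi))).

Definition F2bar (Psi : int -> scalars) : series xphi * series xphi :=
  at_xphi (fun f =>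
    opexp (fun g => - (2 : K) *: actL (Psi 0) 0 g)
      (act false (tpow (- 1))
        (opexp (fun g => - vf_pos (even_pos Psi) (odd_pos Psi) g) f))).

Definition no_constant_term (f : scalars) : Prop := f mon1 = 0.

Definition has_parity (s : bool) (f : scalars) : Prop :=
  forall m, mon_parity m != s -> f m = 0.

(* Local finiteness is what makes sum_j (Psi_j L_j + Psi_{j-1/2} G_{j-1/2})
   a formal series in the variables A, B, M, N. *)
Definition locally_finite (Psi : int -> scalars) : Prop :=
  forall m, finite_set [set p | Psi p m != 0].

Definition is_Psi (Psi : int -> scalars) : Prop :=
  [/\ locally_finite Psi,
      forall p, no_constant_term (Psi p),
      forall p, has_parity (odd `|p|%N) (Psi p)
    & F1bar Psi = scomp (F2bar Psi) (scomp Kbar Hbar)].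

End Sewing.
End Series.

(* Generators of U_P(ns): d, L_n, G_{n+1/2} and P_{n/2}. *)
Inductive ns_gen := Gen_d | Gen_L of int | Gen_G of int | Gen_P of int.

Definition ns_gen_code (g : ns_gen) : unit + int + int + int :=
  match g with
  | Gen_d => inl (inl (inl tt))
  | Gen_L n => inl (inl (inr n))
  | Gen_G n => inl (inr n)
  | Gen_P n => inr n
  end.

Definition ns_gen_decode (c : unit + int + int + int) : ns_gen :=
  match c with
  | inl (inl (inl _)) => Gen_d
  | inl (inl (inr n)) => Gen_L n
  | inl (inr n) => Gen_G n
  | inr n => Gen_P n
  end.

Lemma ns_gen_codeK : cancel ns_gen_code ns_gen_decode.
Proof. by case. Qed.

HB.instance Definition _ := Choice.copy ns_gen (can_type ns_gen_codeK).

Section NeveuSchwarz.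
Context (K : fieldType).

Definition is_Gen_G (g : ns_gen) : bool := if g is Gen_G _ then true else false.

Definition ns_words : superbasis := @SuperBasis {fmonom ns_gen} mone
  (fun u v => Some (mmul u v)) (fun u => odd (count is_Gen_G u)).

(* The free algebra on the generators; U_P(ns) is its quotient by [UP_ideal]. *)
Definition ns_free := {malg K[{fmonom ns_gen}]}.

Definition gd : ns_free := << fmu Gen_d >>.
Definition gL (n : int) : ns_free := << fmu (Gen_L n) >>.
Definition gG (n : int) : ns_free := << fmu (Gen_G n) >>.
Definition gP (n : int) : ns_free := << fmu (Gen_P n) >>.

(* [UP_rel a b]: a = b is a defining relation of U_P(ns). *)
Inductive UP_rel : ns_free -> ns_free -> Prop :=
| rel_LL (m n : int) : UP_rel (gL m * gL n - gL n * gL m)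
    ((m - n)%:~R *: gL (m + n)
     + ((m ^+ 3 - m)%:~R / 12 * (m + n == 0)%:R) *: gd)
| rel_GL (m n : int) : UP_rel (gG m * gL n - gL n * gG m)
    ((m%:~R - (n - 1)%:~R / 2) *: gG (m + n))
| rel_GG (m n : int) : UP_rel (gG m * gG (n - 1) + gG (n - 1) * gG m)
    ((2 : K) *: gL (m + n)
     + ((m ^+ 2 + m)%:~R / 3 * (m + n == 0)%:R) *: gd)
| rel_dL (n : int) : UP_rel (gd * gL n) (gL n * gd)
| rel_dG (n : int) : UP_rel (gd * gG n) (gG n * gd)
| rel_PP (i j : int) : UP_rel (gP i * gP j) ((i == j)%:R *: gP i)
| rel_PL (i m : int) : UP_rel (gP i * gL m) (gL m * gP (i + 2 * m))
| rel_PG (i m : int) :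
    UP_rel (gP i * gG (m - 1)) (gG (m - 1) * gP (i + 2 * m - 1))
| rel_Pd (i : int) : UP_rel (gP i * gd) (gd * gP i).

Inductive UP_ideal : ns_free -> Prop :=
| UP_ideal_rel a b : UP_rel a b -> UP_ideal (a - b)
| UP_ideal0 : UP_ideal 0
| UP_idealD a b : UP_ideal a -> UP_ideal b -> UP_ideal (a + b)
| UP_idealMl c a : UP_ideal a -> UP_ideal (c * a)
| UP_idealMr c a : UP_ideal a -> UP_ideal (a * c).

Definition UP_eq (a b : ns_free) : Prop := UP_ideal (a - b).

Definition term (c : scalars K) (g : ns_gen) : series K ns_words :=
  smul (lift ns_words c) (scst K 0 (fmu g : ns_words)).

(* sum_{j >= 1} (a_j L_j + b_{j-1/2} G_{j-1/2}), same conventions as [vf_pos] *)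
Definition ns_pos (a b : nat -> scalars K) : series K ns_words :=
  ssum (fun i : nat => term (a i) (Gen_L i.+1%:Z) + term (b i) (Gen_G i%:Z)).
(* sum_{j >= 1} (a_j L_{-j} + b_{j-1/2} G_{-j+1/2}) *)
Definition ns_neg (a b : nat -> scalars K) : series K ns_words :=
  ssum (fun i : nat =>
    term (a i) (Gen_L (- i.+1%:Z)) + term (b i) (Gen_G (- i.+1%:Z))).

(* Coefficient of t^k M in f t^{-2 L_0} g, where
   t^{-2 L_0} = sum_{p in Z} P_{p/2} t^{-p} is infinite in both directions. *)
Definition around_tL0 (f g : series K ns_words) (M : monomial) (k : int) :
  ns_free :=
  \sum_(p \in [set: int])
    tcoef k (smul f (smul (scst K (- p) (fmu (Gen_P p) : ns_words)) g) M).

Definition is_Gamma (Psi : int -> scalars K) (Gamma : scalars K) : Prop :=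
  [/\ no_constant_term Gamma,
      has_parity false Gamma
    & forall M k, UP_eq
        (around_tL0 (sexp (- ns_pos (@vA K) (@vM K)))
                    (sexp (- ns_neg (@vB K) (@vN K))) M k)
        (around_tL0
           (smul (sexp (ns_neg (even_neg Psi) (odd_neg Psi)))
             (smul (sexp (ns_pos (even_pos Psi) (odd_pos Psi)))
               (sexp ((2 : K) *: term (Psi 0) (Gen_L 0)))))
           (sexp (term Gamma Gen_d)) M k)].

(* K[A][M][B][N][[t^-1]] *)
Definition polynomial_power_series (f : scalars K) : Prop :=
  (forall m (k : int), 0 < k -> (f m)@_k = 0) /\
  (forall k : int, finite_set [set m | (f m)@_k != 0]).

End NeveuSchwarz.

(* Main.v *)
(** Give A_j, M_{j-1/2} the weights j, j - 1/2, and let wA, wB be the total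
weights of a monomial in the variables (A, M) and (B, N).  Since
t^{-2 L_0} L_{-j} = t^{-2 j} L_{-j} t^{-2 L_0}, a power t^{-k} can only
accompany monomials with 2 wB = k, while conjugation by powers of L_0 forces
wA - wB = j in Psi_j and wA = wB in Gamma.  Finitely many monomials have given
weights, and 2 wB = k forces k >= 0.

Both homogeneity statements are proved by induction on the number of variables
of a monomial M: modulo terms which are homogeneous by induction, the
coefficient of M in the first component of the sewing equation is the sum of
the Psi_p(M) times pairwise distinct basis elements phi^e x^n, so no
inhomogeneous term can occur in Psi_p(M).

For Gamma the equation holds only in the quotient U_P(ns), so one needs a
module on which d does not vanish.  The super-densities, extended by a trivial
submodule (spanned by u) and a trivial quotient (spanned by w) through two
cocycles whose Yoneda product is the Neveu-Schwarz cocycle, carry d : w |-> 24 u.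
The u-coefficient of the action on w kills all homogeneous terms of the wrong
degree. *)

Require Import Defs.
From HB Require Import structures.
From mathcomp Require Import all_boot all_order all_algebra finmap.
From mathcomp Require Import boolp classical_sets functions cardinality.
From mathcomp Require Import fsbigop reals complex monalg zify ring.

Set Implicit Arguments.
Unset Strict Implicit.
Unset Printing Implicit Defensive.

Import Order.TTheory GRing.Theory Num.Theory.

Local Open Scope classical_set_scope.
Local Open Scope ring_scope.
Local Notation lift := Defs.lift.

(** * Finite sums and monomials *)

(** Sums with infinite support and missing inverses are 0 by convention. Bounds on supports pass
    through these conventions, but reading off a coefficient needs finite support; it comes from the
    finitely many divisors of a monomial, from operators that add variables, and from the local
    finiteness of Psi. The default value of [sinv] can only be felt at x^n with n < 0, where the
    wrong-degree part of F^(2) vanishes. Origin of the module: for integral n, v_n is the 1-form x^n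
    dx/x, and for half-integral s, v_s is the 1/2-density x^s (dx/x)^(1/2); L_m acts as the vector
    field - x^(m+1) d/dx. Up to sign, the cocycles on the even part are f -> f'' dx and (f, omega)
    -> Res f' omega, and their product Res f' g'' dx gives the Gelfand-Fuchs cocycle. On w it yields
    (m+1)(m^2-m) - (1-m)(m^2+m) = 2 (m^3-m) for L_m, L_{-m}; comparison with (m^3-m)/12 forces d w =
    24 u. Since 24 must be invertible to recover Gamma, 2 and 3 are assumed nonzero in [K]. *)

Section FiniteSums.
Context (I : choiceType).

Lemma raddf_fsum (U V : zmodType) (h : {additive U -> V}) (P : set I)
    (F : I -> U) :
  finite_set (P `&` [set i | F i != 0]) ->
  h (\sum_(i \in P) F i) = \sum_(i \in P) h (F i).
Proof.
move=> fin.
have -> : \sum_(i \in P) F i = \sum_(i \in P `&` [set i | F i != 0]) F i.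
  apply/esym/fsbig_widen => [i []//|i [Pi nF]] /=.
  by apply/eqP; apply: contrapT => /negP Fi; apply: nF.
have -> : \sum_(i \in P) h (F i) = \sum_(i \in P `&` [set i | F i != 0]) h (F i).
  apply/esym/fsbig_widen => [i []//|i [Pi nF]] /=.
  have -> : F i = 0.
    by apply/eqP; apply: contrapT => /negP Fi; apply: nF.
  by rewrite raddf0.
by rewrite !fsbig_finite // raddf_sum.
Qed.

Lemma fsum_eq1 (V : zmodType) (P : set I) (F : I -> V) (i0 : I) :
  P i0 -> (forall i, P i -> i <> i0 -> F i = 0) -> \sum_(i \in P) F i = F i0.
Proof.
move=> Pi0 F0; rewrite -(fsbig_widen [set i0]) ?fsbig_set1 //.
  by move=> i ->.
by move=> i [Pi ni] /=; apply: F0.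
Qed.

Lemma raddf_fsum1 (U V : zmodType) (h : {additive U -> V}) (P : set I)
    (F : I -> U) (i0 : I) :
  finite_set (P `&` [set i | F i != 0]) -> P i0 ->
  (forall i, P i -> i <> i0 -> h (F i) = 0) ->
  h (\sum_(i \in P) F i) = h (F i0).
Proof. by move=> fin Pi0 F0; rewrite raddf_fsum // (fsum_eq1 Pi0). Qed.

(** Over an infinite support the sum is 0 by convention, over a finite one [h] distributes, so both
    cases give 0. The bounds on supports, starting with [msupp_fsum], rest on this. *)
Lemma raddf_fsum0 (U V : zmodType) (h : {additive U -> V}) (P : set I)
    (F : I -> U) :
  (forall i, P i -> h (F i) = 0) -> h (\sum_(i \in P) F i) = 0.
Proof.
move=> F0; rewrite raddf_sum big1_seq // => i /=.
by case: finite_supportP => //= X XP _ _ Xi; apply/F0/XP.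
Qed.

Lemma msupp_fsum (K : fieldType) (T : choiceType) (P : set I)
    (F : I -> {malg K[T]}) (c : T) :
  c \in msupp (\sum_(i \in P) F i) -> exists2 i, P i & c \in msupp (F i).
Proof.
rewrite -mcoeff_neq0; apply: contraPP => /forall2NP H; apply/negP; rewrite negbK.
rewrite (raddf_fsum0 (h := mcoeff c)) // => i Pi.
by have [//|/negP nc] := H i; apply/eqP; rewrite mcoeff_eq0.
Qed.

Lemma msupp_sum (K : fieldType) (T : choiceType) (s : seq I)
    (F : I -> {malg K[T]}) (c : T) :
  c \in msupp (\sum_(i <- s) F i) -> exists2 i, i \in s & c \in msupp (F i).
Proof.
rewrite -mcoeff_neq0; apply: contraPP => /forall2NP H; apply/negP; rewrite negbK.
rewrite raddf_sum big1_seq // => i /= si.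
by have [//|/negP nc] := H i; apply/eqP; rewrite mcoeff_eq0.
Qed.

End FiniteSums.

Section Monomials.
Implicit Types (m M : monomial) (p : monomial * monomial).

(** One parametric weight serves both for the number of variables [mdg], which drives the
    inductions, and for the two weights [wgt]. *)
Definition mwt (ve : evar -> nat) (vo : ovar -> nat) (m : monomial) : nat :=
  (\sum_(v <- finsupp m.1) m.1 v * ve v + \sum_(v <- m.2) vo v)%N.

Lemma mwt1 ve vo : mwt ve vo mon1 = 0%N.
Proof. by rewrite /mwt /= mdom1 !big_seq_fset0. Qed.

Lemma mwt_even ve vo v : mwt ve vo (mon_even v) = ve v.
Proof. by rewrite /mwt /= mdomU big_seq_fset0 big_seq_fset1 cmUU addn0 mul1n. Qed.

Lemma mwt_odd ve vo v : mwt ve vo (mon_odd v) = vo v.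
Proof. by rewrite /mwt /= mdom1 big_seq_fset0 big_seq_fset1. Qed.

Lemma mwt_factors ve vo M p :
  factors M p -> mwt ve vo M = (mwt ve vo p.1 + mwt ve vo p.2)%N.
Proof.
case: p => -[m1 s1] [m2 s2] [/= E1 E2 disj]; rewrite /mwt /= {}E1 {}E2.
(* Both supports are enlarged to their union, so that the exponents can be added termwise. *)
have W (m : {cmonom evar}) d : (finsupp m `<=` d)%fset ->
    (\sum_(v <- finsupp m) m v * ve v = \sum_(v <- d) m v * ve v)%N.
  move=> le; rewrite (big_fset_incl _ le) // => v vd.
  by rewrite -cmE_neq0 negbK => /eqP ->.
rewrite [LHS]addnC (W m1 (finsupp m1 `|` finsupp m2)%fset) ?fsubsetUl //.
rewrite (W m2 (finsupp m1 `|` finsupp m2)%fset) ?fsubsetUr // mdomD.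
have -> : (\sum_(v <- (s1 `|` s2)%fset) vo v = \sum_(v <- s1) vo v + \sum_(v <- s2) vo v)%N.
  rewrite (big_fsetID _ [in s1]) /=; congr (_ + _)%N; apply: eq_fbigl => v.
    by rewrite !inE /=; case: (v \in s1) => //=; rewrite andbF.
  rewrite !inE /=; have := fdisjointP disj v.
  by case: (v \in s1) => //=; [move=> /(_ isT) /negPf -> | rewrite andbT].
rewrite [LHS]addnC addnACA -big_split /=.
by congr (_ + _)%N; apply: eq_bigr => v _; rewrite cmM mulnDl.
Qed.

Definition mdg : monomial -> nat := mwt (fun=> 1%N) (fun=> 1%N).

Lemma mdg_factors M p : factors M p -> mdg M = (mdg p.1 + mdg p.2)%N.
Proof. exact: mwt_factors. Qed.

Lemma mdg_eq0 m : mdg m = 0%N -> m = mon1.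
Proof.
case: m => m s; rewrite /mdg /mwt /= => /eqP; rewrite addn_eq0 => /andP[/eqP E1].
rewrite sum1_size size_eq0 => /eqP E2; rewrite /mon1; congr (_, _).
  apply: mdeg_eq0I; rewrite mdegE -[RHS]E1.
  by apply: eq_bigr => v _; rewrite muln1.
by apply/fsetP => v; rewrite in_fset0 -[v \in s]/(v \in enum_fset s) E2.
Qed.

Lemma mdg1 : mdg mon1 = 0%N. Proof. exact: mwt1. Qed.

Lemma factors_l1 M : factors M (mon1, M).
Proof.
by split; rewrite /= ?mul1m ?fset0U ?fdisjoint0X.
Qed.

Lemma factors_r1 M : factors M (M, mon1).
Proof.
by split; rewrite /= ?mulm1 ?fsetU0 ?fdisjointX0.
Qed.

Lemma factors_inj2 M m : factors M (mon1, m) -> m = M.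
Proof.
case: M m => M1 M2 [m1 m2] [/= E1 E2 _].
by rewrite E1 E2 mul1m fset0U.
Qed.

Lemma factors_inj1 M m : factors M (m, mon1) -> m = M.
Proof.
case: M m => M1 M2 [m1 m2] [/= E1 E2 _].
by rewrite E1 E2 mulm1 fsetU0.
Qed.

(** The number of variables is additive, so the cofactor has none. This lemma and the next one
    separate the extreme factorisations from those covered by an induction hypothesis. *)
Lemma factors_l0 M p : factors M p -> mdg p.1 = mdg M -> p = (M, mon1).
Proof.
move=> fp E; have := mdg_factors fp; rewrite E => /esym/eqP.
rewrite -[X in _ == X]addn0 eqn_add2l => /eqP /mdg_eq0 E2.
by case: p E2 fp {E} => m1 m2 /= -> /factors_inj1 ->.
Qed.

Lemma factors_r0 M p : factors M p -> mdg p.2 = mdg M -> p = (mon1, M).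
Proof.
move=> fp E; have := mdg_factors fp; rewrite E => /esym/eqP.
rewrite -[X in _ == X]add0n eqn_add2r => /eqP /mdg_eq0 E2.
by case: p E2 fp {E} => m1 m2 /= -> /factors_inj2 ->.
Qed.

Lemma factors1 p : factors mon1 p -> p = (mon1, mon1).
Proof.
move=> fp; apply: factors_r0 => //.
by have := mdg_factors fp; rewrite mdg1; lia.
Qed.

Lemma finite_cmonom (T : choiceType) (X : {fset T}) (N : nat) :
  finite_set [set m : {cmonom T} |
    (finsupp m `<=` X)%fset /\ forall v, (m v <= N)%N].
Proof.
pose g (f : {ffun X -> 'I_N.+1}) : {cmonom T} :=
  [cmonom nat_of_ord (f i) | i : X]%M.
apply: (@sub_finite_set _ _ (g @` setT)); last first.
  by apply: finite_image; exact: finite_finset.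
move=> m [sX mN] /=; exists [ffun i : X => inord (m (val i))] => //.
apply/eqP/cmP => v; rewrite /g cmE fsfun_ffun.
case: insubP => [u uX <-|nX] /=; first by rewrite ffunE inordK // ltnS mN.
by apply/esym/eqP; rewrite cmE_eq0; apply: contra nX => /(fsubsetP sX).
Qed.

Lemma finite_fsubsets (T : choiceType) (X : {fset T}) :
  finite_set [set s : {fset T} | (s `<=` X)%fset].
Proof.
apply: (@finite_subfset _ (fpowerset X)) => s /= sX.
by rewrite fpowersetE.
Qed.

Lemma finite_monomials (X : {fset evar}) (N : nat) (Y : {fset ovar}) :
  finite_set [set m : monomial |
    [/\ (finsupp m.1 `<=` X)%fset, forall v, (m.1 v <= N)%N
      & (m.2 `<=` Y)%fset]].
Proof.
apply: (@sub_finite_set _ _ ([set m : {cmonom evar} |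
    (finsupp m `<=` X)%fset /\ forall v, (m v <= N)%N] `*`
    [set s : {fset ovar} | (s `<=` Y)%fset])).
  by move=> m [].
by apply: finite_setX; [exact: finite_cmonom | exact: finite_fsubsets].
Qed.

Lemma mdg_ge m v : (m.1 v <= mdg m)%N.
Proof.
rewrite /mdg /mwt; have [vm|vm] := boolP (v \in finsupp m.1).
  rewrite (big_fsetD1 v) //= muln1; lia.
by move: vm; rewrite -cmE_eq0 => /eqP ->.
Qed.

Definition divides m M := exists m', factors M (m, m').

Lemma finite_divisors M : finite_set [set m | divides m M].
Proof.
apply: (@sub_finite_set _ _ _ _ (@finite_monomials (finsupp M.1) (mdg M) M.2)).
move=> m [m' fM]; have [/= E1 E2 _] := fM; split.
- by rewrite E1 mdomD fsubsetUl.
- by move=> v; have := mdg_factors fM; have := mdg_ge m v => /=; lia.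
- by rewrite E2 fsubsetUl.
Qed.

Lemma factors_sym M m m' : factors M (m, m') -> factors M (m', m).
Proof.
by case=> /= E1 E2 E3; split; rewrite /= 1?mulmC 1?fsetUC 1?fdisjoint_sym.
Qed.

Lemma finite_factors M : finite_set (factors M).
Proof.
apply: (@sub_finite_set _ _ ([set m | divides m M] `*` [set m | divides m M])).
  by move=> [m m'] fM; split; [exists m' | exists m; apply: factors_sym].
by apply: finite_setX; exact: finite_divisors.
Qed.

End Monomials.

Lemma mcoeff_sum (K : fieldType) (T I : choiceType) (s : seq I)
    (F : I -> {malg K[T]}) (c : T) :
  (\sum_(i <- s) F i)@_c = \sum_(i <- s) (F i)@_c.
Proof. exact: raddf_sum. Qed.

(** * Products of series and homogeneity *)

Section Coefficients.
Context (K : fieldType) (W : superbasis).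
Implicit Types (f g : coefs K W) (a b c : int * W).

Lemma mcoeff_ctwist s f c :
  (ctwist s f)@_c = (-1) ^+ (s && sb_parity c.2) * f@_c.
Proof.
rewrite /ctwist mcoeff_sum /= [in RHS](monalgE f) mcoeff_sum mulr_sumr.
apply: eq_bigr => a _; rewrite !mcoeffU -mulrnAr.
by case: eqP => [->|]; rewrite ?mulr0n ?mulr0.
Qed.

Lemma ctwist0 f : ctwist false f = f.
Proof. by apply/malgP => c; rewrite mcoeff_ctwist expr0 mul1r. Qed.

Lemma msupp_ctwist s f c : c \in msupp (ctwist s f) -> c \in msupp f.
Proof.
by rewrite -!mcoeff_neq0 mcoeff_ctwist mulf_eq0 negb_or => /andP[].
Qed.

Lemma msupp_cmul f g c : c \in msupp (cmul f g) ->
  exists a b, [/\ a \in msupp f, b \in msupp g,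
    sb_mul a.2 b.2 = Some c.2 & c.1 = a.1 + b.1].
Proof.
case/msupp_sum => a af /msupp_sum [b bg].
case E: sb_mul => [d|]; last by rewrite msupp0 inE.
move=> /(fsubsetP msuppU_le); rewrite inE => /eqP ->.
by exists a, b.
Qed.

Lemma cmul0f g : cmul 0 g = 0.
Proof. by rewrite /cmul msupp0 big_seq_fset0. Qed.

Lemma cmulf0 f : cmul f 0 = 0.
Proof. by rewrite /cmul big1 // => a _; rewrite msupp0 big_seq_fset0. Qed.

Lemma cmulfN f g : cmul f (- g) = - cmul f g.
Proof.
rewrite /cmul msuppN -sumrN; apply: eq_bigr => a _; rewrite -sumrN.
apply: eq_bigr => b _; case: sb_mul => [d|]; last by rewrite oppr0.
by rewrite -monalgUN mcoeffN mulrN.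
Qed.

Definition umul a b (x : K) : coefs K W :=
  if sb_mul a.2 b.2 is Some c then << x *g (a.1 + b.1, c) >> else 0.

Lemma umul0 a b : umul a b 0 = 0.
Proof. by rewrite /umul; case: sb_mul => // c; rewrite monalgU0. Qed.

Lemma cmulE (X Y : {fset (int * W)}) f g :
  (msupp f `<=` X)%fset -> (msupp g `<=` Y)%fset ->
  cmul f g = \sum_(a <- X) \sum_(b <- Y) umul a b (f@_a * g@_b).
Proof.
move=> fX gY; rewrite /cmul (big_fset_incl _ fX) /=.
  apply: eq_bigr => a _; apply: big_fset_incl => // b _ /mcoeff_outdom E.
  by rewrite E mulr0; exact: umul0.
move=> a _ /mcoeff_outdom E; rewrite big1 // => b _.
by rewrite E mul0r; exact: umul0.
Qed.

Lemma cmul_mono f b y :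
  cmul f << y *g b >> = \sum_(a <- msupp f) umul a b (f@_a * y).
Proof.
rewrite (cmulE (fsubset_refl _) msuppU_le); apply: eq_bigr => a _.
by rewrite big_seq_fset1 mcoeffUU.
Qed.

Lemma cmul_mono2 a b x y : cmul << x *g a >> << y *g b >> = umul a b (x * y).
Proof. by rewrite (cmulE msuppU_le msuppU_le) !big_seq_fset1 !mcoeffUU. Qed.

(** Multiplication by a basis element may kill or identify basis elements; the condition on [z]
    excludes a second contribution at the same place. *)
Lemma mcoeff_mono_cmul x a g l w z :
  sb_mul a.2 w = Some z -> (forall w', sb_mul a.2 w' = Some z -> w' = w) ->
  (cmul << x *g a >> g)@_(a.1 + l, z) = x * g@_(l, w).
Proof.
move=> E inj; rewrite (cmulE msuppU_le (fsubset_refl _)) big_seq_fset1 mcoeffUU.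
rewrite mcoeff_sum [in RHS](monalgE g) mcoeff_sum mulr_sumr.
apply: eq_bigr => -[k w'] _; rewrite mcoeffU /umul /=.
case: ((k, w') =P (l, w)) => [[-> ->]|ne]; first by rewrite E mcoeffUU.
rewrite mulr0n mulr0; case E': sb_mul => [z'|]; last by rewrite mcoeff0.
rewrite mcoeffU; case: eqP => // -[/addrI kl zz]; case: ne.
by rewrite kl (inj w') // E' zz.
Qed.

End Coefficients.

Section Lift.
Context (K : fieldType) (W : superbasis).

Lemma mcoeff_lift (a : scalars K) M (c : int * W) :
  (lift W a M)@_c = if c.2 == sb_one W then (a M)@_c.1 else 0.
Proof.
rewrite /lift mcoeff_sum; case: c => k w /=; case: eqP => [->|ne].
  rewrite [in RHS](monalgE (a M)) mcoeff_sum.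
  by apply: eq_bigr => l _; rewrite !mcoeffU xpair_eqE eqxx andbT.
rewrite big1 // => l _; rewrite mcoeffU xpair_eqE.
by case: (sb_one W =P w) ne => [->|_ _] //; rewrite andbF.
Qed.

Lemma lift_eq0 (a : scalars K) M : a M = 0 -> lift W a M = 0.
Proof. by move=> E; rewrite /lift E msupp0 big_seq_fset0. Qed.

Lemma lift_mono (a : scalars K) M k :
  a M = << k >> -> lift W a M = << (k, sb_one W) >>.
Proof.
move=> E; apply/malgP => -[l w]; rewrite mcoeff_lift E !mcoeffU xpair_eqE /=.
by rewrite [w == _]eq_sym; case: (_ == w); rewrite ?andbF ?andbT.
Qed.

Hypothesis one_mul : forall w : W, sb_mul (sb_one W) w = Some w.

Lemma mcoeff_cmul_lift (a : scalars K) M (y : K) k (w : W) (c : int * W) :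
  (cmul (lift W a M) << y *g (k, w) >>)@_c =
  if c.2 == w then (a M)@_(c.1 - k) * y else 0.
Proof.
rewrite cmul_mono mcoeff_sum /=.
have -> : \sum_(b <- msupp (lift W a M)) (umul b (k, w) ((lift W a M)@_b * y))@_c =
   \sum_(b <- msupp (lift W a M)) (if c.2 == w then
      y * (lift W a M)@_b *+ (b == (c.1 - k, sb_one W)) else 0).
  apply: eq_bigr => -[l v] _; rewrite mcoeff_lift /=.
  case: (eqVneq v) => [->|nv]; last by rewrite mul0r umul0 mcoeff0 mulr0 mul0rn if_same.
  rewrite /umul /= one_mul mcoeffU xpair_eqE eqxx andbT; case: c => c1 c2 /=.
  rewrite xpair_eqE [w == _]eq_sym; case: (c2 == w); rewrite ?andbF ?andbT //.
  by rewrite -[l == _](inj_eq (addIr k)) subrK mulrC.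
case: (c.2 == w); last by rewrite big1.
transitivity (y * (lift W a M)@_(c.1 - k, sb_one W)); last first.
  by rewrite mcoeff_lift /= eqxx mulrC.
rewrite [in RHS](monalgE (lift W a M)) mcoeff_sum mulr_sumr.
by apply: eq_bigr => b _; rewrite mcoeffU mulrnAr.
Qed.

End Lift.

Section Products.
Context (K : fieldType) (W : superbasis).
Implicit Types (f g u : series K W) (M m : monomial).

Definition pterm f g (p : monomial * monomial) : coefs K W :=
  (-1) ^+ inversions p.1 p.2 *: cmul (ctwist (mon_parity p.2) (f p.1)) (g p.2).

Lemma smulE f g M : smul f g M = \sum_(p \in factors M) pterm f g p.
Proof. by []. Qed.

Lemma msupp_pterm f g p c : c \in msupp (pterm f g p) ->
  exists a b, [/\ a \in msupp (f p.1), b \in msupp (g p.2),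
    sb_mul a.2 b.2 = Some c.2 & c.1 = a.1 + b.1].
Proof.
move=> /(fsubsetP (msuppZ_le _ _)) /msupp_cmul [a [b [af bg E1 E2]]].
by exists a, b; split=> //; apply: msupp_ctwist af.
Qed.

Lemma msupp_smul f g M c : c \in msupp (smul f g M) ->
  exists p a b, [/\ factors M p, a \in msupp (f p.1), b \in msupp (g p.2),
    sb_mul a.2 b.2 = Some c.2 & c.1 = a.1 + b.1].
Proof.
case/msupp_fsum => p fp /msupp_pterm [a [b [af bg E1 E2]]].
by exists p, a, b.
Qed.

Lemma pterm_l0 f g p : f p.1 = 0 -> pterm f g p = 0.
Proof.
move=> E; rewrite /pterm E (_ : ctwist _ 0 = 0) ?cmul0f ?scaler0 //.
by rewrite /ctwist msupp0 big_seq_fset0.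
Qed.

Lemma pterm_r0 f g p : g p.2 = 0 -> pterm f g p = 0.
Proof. by move=> E; rewrite /pterm E cmulf0 scaler0. Qed.

Lemma mon_parity1 : mon_parity mon1 = false.
Proof. by rewrite /mon_parity (_ : mon1.2 = fset0) // cardfs0. Qed.

Lemma inversions_l1 m : inversions mon1 m = 0%N.
Proof. by rewrite /inversions big_seq_fset0. Qed.

Lemma inversions_r1 m : inversions m mon1 = 0%N.
Proof. by rewrite /inversions big1 // => u _; rewrite big_seq_fset0. Qed.

Lemma pterm_r1 f g m : pterm f g (m, mon1) = cmul (f m) (g mon1).
Proof. by rewrite /pterm /= inversions_r1 mon_parity1 ctwist0 expr0 scale1r. Qed.

Lemma pterm_l1 f g m :
  pterm f g (mon1, m) = cmul (ctwist (mon_parity m) (f mon1)) (g m).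
Proof. by rewrite /pterm /= inversions_l1 expr0 scale1r. Qed.

Lemma smul_mon1 f g : smul f g mon1 = cmul (f mon1) (g mon1).
Proof.
rewrite smulE (fsum_eq1 (factors_l1 mon1)) ?pterm_r1 // => p /factors1 -> //.
Qed.

Lemma smul_eq0 f g M :
  (forall p, factors M p -> f p.1 = 0 \/ g p.2 = 0) -> smul f g M = 0.
Proof.
move=> H; rewrite smulE fsbig1 // => p /H [] E; [exact: pterm_l0|exact: pterm_r0].
Qed.

Lemma smul_eq1 f g M : 
  (forall p, factors M p -> p <> (M, mon1) -> f p.1 = 0 \/ g p.2 = 0) ->
  smul f g M = cmul (f M) (g mon1).
Proof.
move=> H; rewrite smulE (fsum_eq1 (factors_r1 M)) ?pterm_r1 // => p fp np.
by have [] := H p fp np => E; [exact: pterm_l0|exact: pterm_r0].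
Qed.

Lemma mcoeff_smul1 f g M p0 c : factors M p0 ->
  (forall p, factors M p -> p <> p0 -> c \notin msupp (pterm f g p)) ->
  (smul f g M)@_c = (pterm f g p0)@_c.
Proof.
move=> fp0 H; rewrite smulE (raddf_fsum1 (h := mcoeff c) _ fp0) //.
  exact/finite_setIl/finite_factors.
by move=> p fp np /=; apply: mcoeff_outdom; exact: H.
Qed.

End Products.

(** * Series homogeneous for an additive grading *)

Section Homogeneity.
Context (K : fieldType) (W : superbasis) (Z : zmodType).
Context (wt : monomial -> Z) (dl : int * W -> Z).
Hypothesis wtM : forall M p, factors M p -> wt M = wt p.1 + wt p.2.
Hypothesis dlM : forall a b c : int * W,
  sb_mul a.2 b.2 = Some c.2 -> c.1 = a.1 + b.1 -> dl c = dl a + dl b.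

Context (S : set monomial).
Hypothesis S_div : forall M p, factors M p -> S M -> S p.1 /\ S p.2.

(** [S] is closed under divisors: it is either the set of all monomials or the set of those with
    fewer variables than a given [M]. In the second case [homog] expresses an induction hypothesis,
    and closure makes it stable under products. Only supports are constrained, so the signs in
    [smul] do not intervene. *)
Definition homog (a : Z) (f : series K W) : Prop :=
  forall m, S m -> forall c, c \in msupp (f m) -> wt m + dl c = a.

Implicit Types (f g : series K W).

Lemma pterm_homog a b f g p : homog a f -> homog b g -> S p.1 -> S p.2 ->
  forall M c, factors M p -> c \in msupp (pterm f g p) -> wt M + dl c = a + b.
Proof.
move=> hf hg S1 S2 M c fp /msupp_pterm [x [y [xf yg E1 E2]]].
by rewrite (wtM fp) (dlM E1 E2) addrACA (hf _ S1 _ xf) (hg _ S2 _ yg).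
Qed.

Lemma smul_homog a b f g : homog a f -> homog b g -> homog (a + b) (smul f g).
Proof.
move=> hf hg M SM c /msupp_fsum [p fp cp].
by have [S1 S2] := S_div fp SM; apply: pterm_homog cp.
Qed.

(* No summability is needed: a sum with infinite support is 0 by convention. *)
Lemma ssum_homog (I : choiceType) a (u : I -> series K W) :
  (forall i, homog a (u i)) -> homog a (ssum u).
Proof. by move=> h M SM c /msupp_fsum [i _]; apply: h. Qed.

Lemma homog0 a : homog a 0.
Proof. by move=> M _ c; rewrite [(0 : series K W) M]/(0 : coefs K W) msupp0 inE. Qed.

Lemma homogD a f g : homog a f -> homog a g -> homog a (f + g).
Proof.
move=> hf hg M SM c /(fsubsetP (msuppD_le _ _)); rewrite inE.
by case/orP; [apply: hf|apply: hg].
Qed.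

Lemma homogZ a (x : K) f : homog a f -> homog a (x *: f).
Proof. by move=> hf M SM c /(fsubsetP (msuppZ_le _ _)); apply: hf. Qed.

Lemma homogN a f : homog a f -> homog a (- f).
Proof.
by move=> hf M SM c; rewrite [(- f) M]/(- f M) msuppN; apply: hf.
Qed.

Lemma iter_homog a (D : series K W -> series K W) f n :
  (forall g, homog a g -> homog a (D g)) -> homog a f -> homog a (iter n D f).
Proof. by move=> hD hf; elim: n => //= n; apply: hD. Qed.

Lemma opexp_homog a (D : series K W -> series K W) f :
  (forall g, homog a g -> homog a (D g)) -> homog a f -> homog a (opexp D f).
Proof. by move=> hD hf; apply: ssum_homog => n; apply/homogZ/iter_homog. Qed.

Lemma scst_homog k w : wt mon1 = 0 -> homog (dl (k, w)) (scst K k w).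
Proof.
move=> w0 M _ c; rewrite /scst; case: eqP => [->|_]; last by rewrite msupp0 inE.
by move=> /(fsubsetP msuppU_le); rewrite inE => /eqP ->; rewrite w0 add0r.
Qed.

Lemma sexp_homog u : wt mon1 = 0 -> dl (0, sb_one W) = 0 ->
  homog 0 u -> homog 0 (sexp u).
Proof.
move=> w0 d0 hu; apply: opexp_homog => [g hg|].
  by rewrite -[X in homog X]addr0; apply: smul_homog.
by rewrite -d0; apply: scst_homog.
Qed.

Lemma lift_homog b (a : scalars K) :
  (forall m, S m -> forall k, k \in msupp (a m) -> wt m + dl (k, sb_one W) = b) ->
  homog b (lift W a).
Proof.
move=> ha M SM c /msupp_sum [k kM /(fsubsetP msuppU_le)].
by rewrite inE => /eqP ->; apply: ha.
Qed.

End Homogeneity.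

Section Exponentials.
Context (K : fieldType) (W : superbasis).
Implicit Types (f g u : series K W) (D : series K W -> series K W).

Definition vanish n f := forall m, (mdg m < n)%N -> f m = 0.

(** The filtration by the number of variables replaces a topology: the n-th iterate of such an
    operator starts in degree n, so its exponential is locally finite. *)
Definition raising D := forall n g, vanish n g -> vanish n.+1 (D g).

Lemma seriesN f m : (- f) m = - f m. Proof. by []. Qed.
Lemma seriesD f g m : (f + g) m = f m + g m. Proof. by []. Qed.
Lemma seriesZ (x : K) f m : (x *: f) m = x *: f m. Proof. by []. Qed.

Lemma raising_mon1 D g : raising D -> D g mon1 = 0.
Proof. by move=> /(_ 0%N g) H; apply: H => //; rewrite mdg1. Qed.

Lemma raising_iter D f n : raising D -> vanish n (iter n D f).
Proof. by move=> rD; elim: n => //= n; apply: rD. Qed.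

Lemma raisingN D : raising D -> raising (fun g => - D g).
Proof.
by move=> rD n g vg m mn; rewrite seriesN (rD n g vg m mn) oppr0.
Qed.

Lemma raisingZ (x : K) D : raising D -> raising (fun g => x *: D g).
Proof.
by move=> rD n g vg m mn; rewrite seriesZ (rD n g vg m mn) scaler0.
Qed.

Lemma smul_raising u : u mon1 = 0 -> raising (smul u).
Proof.
move=> u1 n g vg m mn; apply: smul_eq0 => p fp; have := mdg_factors fp.
case: (posnP (mdg p.1)) => [/mdg_eq0 -> _|pos E]; first by left.
by right; apply: vg; lia.
Qed.

Lemma opexp_mon1 D f : raising D -> opexp D f mon1 = f mon1.
Proof.
move=> rD; rewrite /opexp /ssum (fsum_eq1 (i0 := 0%N)) //=.
  by rewrite seriesZ fact0 invr1 scale1r.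
move=> [|i] // _ _; rewrite seriesZ /=.
by rewrite raising_mon1 // scaler0.
Qed.

(** Splits off the orders 0 and 1. It is applied to coefficients of the wrong degree, where higher
    iterates vanish because the operator is then fed a series without constant term. *)
Lemma mcoeff_opexp D f M (c : int * W) : raising D ->
  (forall i, (iter i.+2 D f M)@_c = 0) ->
  (opexp D f M)@_c = (f M)@_c + (D f M)@_c.
Proof.
move=> rD H; rewrite /opexp /ssum raddf_fsum; last first.
  apply: (@sub_finite_set _ _ `I_(mdg M).+1); last exact: finite_II.
  move=> i [_ /=]; rewrite ltnNge; apply: contraNN => Mi.
  by rewrite seriesZ (raising_iter f rD Mi) scaler0.
rewrite (fsbigTE [fset 0%N; 1%N]%fset) /=; last first.
  move=> [|[|i]]; rewrite !inE // => _; rewrite seriesZ.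
  by rewrite mcoeffZ H mulr0.
rewrite big_fsetU1; last by rewrite inE.
rewrite big_seq_fset1 [iter 0 D f]/= [iter 1 D f]/= fact0 (_ : 1`! = 1%N) //.
by rewrite invr1 !scale1r.
Qed.

Lemma sexp_mon1 u : u mon1 = 0 -> sexp u mon1 = << (0, sb_one W) >>.
Proof.
move=> u1; rewrite /sexp opexp_mon1 ?/sone ?/scst ?eqxx //.
exact: smul_raising.
Qed.

Context (Z : zmodType) (wt : monomial -> Z) (dl : int * W -> Z).
Hypothesis wtM : forall M p, factors M p -> wt M = wt p.1 + wt p.2.
Hypothesis dlM : forall a b c : int * W,
  sb_mul a.2 b.2 = Some c.2 -> c.1 = a.1 + b.1 -> dl c = dl a + dl b.

(* Only the factorisation M = M * 1 can contribute to a coefficient of the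
   wrong degree when both factors are homogeneous below the degree of M. *)
Lemma mcoeff_smul_lin u f M a b c : u mon1 = 0 ->
  homog wt dl [set m | (mdg m < mdg M)%N] a u ->
  homog wt dl [set m | (mdg m < mdg M)%N] b f ->
  wt M + dl c != a + b ->
  (smul u f M)@_c = (cmul (u M) (f mon1))@_c.
Proof.
move=> u1 hu hf bad; rewrite (mcoeff_smul1 (factors_r1 M)) ?pterm_r1 //.
move=> p fp np; apply/negP => cp; have E := mdg_factors fp.
have [E1|E1] := eqVneq (mdg p.1) (mdg M); first exact/np/factors_l0.
have [E2|E2] := eqVneq (mdg p.2) (mdg M).
  by move: cp; rewrite pterm_l0 ?msupp0 ?inE // (factors_r0 fp E2).
case/eqP: bad; apply: (pterm_homog wtM dlM hu hf _ _ fp cp) => /=; lia.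
Qed.

End Exponentials.

(** * Superfunctions and vector fields *)

Section Superfunctions.
Context (K : fieldType).
Local Notation xs := (series K xphi).
Local Notation xc := (coefs K xphi).

Definition xdeg (w : xphi) : int := 2 * w.1 + (w.2 : nat)%:Z.

Lemma xdegM (a b c : xphi) : sb_mul a b = Some c -> xdeg c = xdeg a + xdeg b.
Proof.
case: a b c => [n e] [n' e'] [n'' e''] /=.
by case: e e' => [] [] // [<- <-]; rewrite /xdeg /=; lia.
Qed.

Lemma xone_mul (w : xphi) : sb_mul (sb_one xphi) w = Some w.
Proof. by case: w => n e; rewrite /= add0r. Qed.

Lemma linext_mono (g : int * xphi -> xc) a (y : K) :
  linext g << y *g a >> = y *: g a.
Proof.
rewrite /linext (big_fset_incl _ (msuppU_le (k := a) (x := y))) /=.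
  by rewrite big_seq_fset1 mcoeffUU.
by move=> b _ /mcoeff_outdom ->; rewrite scale0r.
Qed.

Lemma linext0 (g : int * xphi -> xc) : linext g 0 = 0.
Proof. by rewrite /linext msupp0 big_seq_fset0. Qed.

Lemma scale_mono (T : choiceType) (y x : K) (a : T) :
  y *: (<< x *g a >> : {malg K[T]}) = << y * x *g a >>.
Proof. by apply/malgP => b; rewrite mcoeffZ !mcoeffU mulrnAr. Qed.

Lemma msupp_linext (g : int * xphi -> xc) f c :
  c \in msupp (linext g f) -> exists2 a, a \in msupp f & c \in msupp (g a).
Proof.
case/msupp_sum => a af /(fsubsetP (msuppZ_le _ _)) cg; by exists a.
Qed.

Lemma msupp_mono (T : choiceType) (y : K) (a c : T) :
  c \in msupp << y *g a >> -> c = a.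
Proof. by move=> /(fsubsetP msuppU_le); rewrite inE => /eqP. Qed.

Lemma msupp_ddx f c : c \in msupp (@ddx K f) ->
  exists a, [/\ a \in msupp f, c.1 = a.1 & xdeg c.2 = xdeg a.2 - 2].
Proof.
case/msupp_linext => a af /(fsubsetP (msuppZ_le _ _)) /msupp_mono ->.
by exists a; split=> //=; rewrite /xdeg /=; lia.
Qed.

Lemma msupp_ddphi f c : c \in msupp (@ddphi K f) ->
  exists a, [/\ a \in msupp f, c.1 = a.1 & xdeg c.2 = xdeg a.2 - 1].
Proof.
case/msupp_linext => -[k [n []]] af /=; last by rewrite msupp0 inE.
move=> /msupp_mono ->.
by exists (k, (n, true)); split=> //=; rewrite /xdeg /=; lia.
Qed.

Lemma msupp_xpow_cmul j (f : xc) c : c \in msupp (cmul (xpow K j) f) ->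
  exists a, [/\ a \in msupp f, c.1 = a.1 & xdeg c.2 = xdeg a.2 + 2 * j].
Proof.
case/msupp_cmul => a [b [/msupp_mono -> bf /xdegM -> ->]].
by exists b; split=> //; rewrite ?add0r // /xdeg /=; lia.
Qed.

Lemma msupp_phi_cmul (f : xc) c : c \in msupp (cmul (phi K) f) ->
  exists a, [/\ a \in msupp f, c.1 = a.1 & xdeg c.2 = xdeg a.2 + 1].
Proof.
case/msupp_cmul => a [b [/msupp_mono -> bf /xdegM -> ->]].
by exists b; split=> //; rewrite ?add0r // /xdeg /=; lia.
Qed.

Lemma msupp_Lx j (f : xc) c : c \in msupp (Lx j f) ->
  exists a, [/\ a \in msupp f, c.1 = a.1 & xdeg c.2 = xdeg a.2 + 2 * j].
Proof.
rewrite /Lx msuppN => /(fsubsetP (msuppD_le _ _)); rewrite inE => /orP[].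
  case/msupp_xpow_cmul => b [/msupp_ddx [a [af E1 E2]] E3 E4].
  by exists a; split=> //; [rewrite E3|rewrite E4 E2; lia].
move=> /(fsubsetP (msuppZ_le _ _)) /msupp_phi_cmul [b [bf E1 E2]].
case/msupp_xpow_cmul: bf => d [/msupp_ddphi [a [af E3 E4]] E5 E6].
by exists a; split=> //; [rewrite E1 E5|rewrite E2 E6 E4; lia].
Qed.

Lemma msupp_Gx j (f : xc) c : c \in msupp (Gx j f) ->
  exists a, [/\ a \in msupp f, c.1 = a.1 & xdeg c.2 = xdeg a.2 + (2 * j + 1)].
Proof.
rewrite /Gx msuppN => /msupp_xpow_cmul [b [+ E1 E2]].
move=> /(fsubsetP (msuppB_le _ _)); rewrite inE => /orP[].
  case/msupp_ddphi => a [af E3 E4].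
  by exists a; split=> //; [rewrite E1|rewrite E2 E4; lia].
case/msupp_phi_cmul => d [/msupp_ddx [a [af E3 E4]] E5 E6].
by exists a; split=> //; [rewrite E1 E5|rewrite E2 E6 E4; lia].
Qed.

Lemma ddx_x (y : K) (s : int) : ddx << y *g (s, ((1, false) : xphi)) >> =
  << y *g (s, ((0, false) : xphi)) >>.
Proof. by rewrite /ddx linext_mono scale_mono mul1r scale_mono mulr1. Qed.

Lemma ddphi_x (y : K) (s : int) : ddphi << y *g (s, ((1, false) : xphi)) >> = 0.
Proof. by rewrite /ddphi linext_mono; apply: scaler0. Qed.

Lemma LxE j (f : xc) :
  ddphi f = 0 -> Lx j f = - cmul (xpow K (j + 1)) (ddx f).
Proof.
move=> E; rewrite /Lx E; congr (- _); apply: etrans (addr0 _).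
congr (_ + _); apply: etrans (scaler0 _ _); congr (_ *: _).
exact: etrans (congr1 (cmul (phi K)) (cmulf0 (xpow K j))) (cmulf0 (phi K)).
Qed.

Lemma GxE j (f : xc) :
  ddphi f = 0 -> Gx j f = cmul (xpow K (j + 1)) (cmul (phi K) (ddx f)).
Proof.
move=> E; rewrite /Gx E -cmulfN; congr cmul.
by rewrite sub0r opprK.
Qed.

Lemma Lx_x j (y : K) (s : int) : Lx j << y *g (s, ((1, false) : xphi)) >> =
  << - y *g (s, ((j + 1, false) : xphi)) >>.
Proof.
rewrite LxE; last exact: ddphi_x.
rewrite ddx_x cmul_mono2 /umul /= monalgUN mul1r.
by rewrite (add0r s) (addr0 (j + 1)).
Qed.

Lemma Gx_x j (y : K) (s : int) : Gx j << y *g (s, ((1, false) : xphi)) >> =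
  << y *g (s, ((j + 1, true) : xphi)) >>.
Proof.
have E : cmul (phi K) << y *g (s, ((0, false) : xphi)) >> =
    << y *g (s, ((0, true) : xphi)) >>.
  by rewrite cmul_mono2 /umul /= mul1r (add0r s) (add0r (0 : int)).
rewrite GxE; last exact: ddphi_x.
rewrite ddx_x; apply: etrans (congr1 (cmul (xpow K (j + 1))) E) _.
rewrite cmul_mono2 /umul /= mul1r (add0r s).
exact: (congr1 (fun z : int => << y *g (s, ((z, true) : xphi)) >>) (addr0 (j + 1))).
Qed.

Lemma Lx0 j : Lx j 0 = 0 :> xc.
Proof.
rewrite LxE; last exact: linext0.
apply: etrans (oppr0 _); congr (- _).
exact: etrans (congr1 (cmul (xpow K (j + 1))) (linext0 _)) (cmulf0 _).
Qed.

Lemma Gx0 j : Gx j 0 = 0 :> xc.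
Proof.
rewrite GxE; last exact: linext0.
apply: etrans (cmulf0 (xpow K (j + 1))); congr (cmul _).
exact: etrans (congr1 (cmul (phi K)) (linext0 _)) (cmulf0 _).
Qed.

Lemma mcoeff_tpow s (f : xc) (k : int) (w : xphi) :
  (tpow s f)@_(k + s * xdeg w, w) = f@_(k, w) :> K.
Proof.
rewrite /tpow /linext mcoeff_sum [in RHS](monalgE f) mcoeff_sum.
apply: eq_bigr => -[l v] _; rewrite scale_mono (mulr1 (f@_(l, v))).
rewrite !mcoeffU !xpair_eqE -[2 * v.1 + _]/(xdeg v).
case: (eqVneq v w) => [->|_]; last by rewrite !andbF.
by rewrite (inj_eq (addIr _)).
Qed.

Lemma msupp_tpow s f c : c \in msupp (@tpow K s f) ->
  exists a, [/\ a \in msupp f, c.1 = a.1 + s * xdeg a.2 & c.2 = a.2].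
Proof. by case/msupp_linext => a af /msupp_mono ->; exists a. Qed.

Lemma tpow_mono (s : int) (y : K) (k : int) (w : xphi) :
  tpow s << y *g (k, w) >> = << y *g (k + s * xdeg w, w) >>.
Proof. by rewrite /tpow linext_mono scale_mono mulr1. Qed.

Lemma act_mon1 s (P : xc -> xc) (f : xs) : act s P f mon1 = P (f mon1).
Proof. by rewrite /act mon_parity1 andbF scale1r. Qed.

Lemma act_vanish s (P : xc -> xc) n f :
  P 0 = 0 -> vanish n f -> vanish n (act s P f).
Proof. by move=> P0 vf m mn; rewrite /act vf // P0 scaler0. Qed.

End Superfunctions.

(* Doubled weights: [s = false] selects the variables A, M and [s = true] the
   variables B, N. *)
Definition evw (s : bool) (v : evar) : nat := if v.1 == s then (2 * v.2.+1)%N else 0%N.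
Definition odw (s : bool) (v : ovar) : nat := if v.1 == s then (2 * v.2).+1 else 0%N.
Definition wgt (s : bool) : monomial -> nat := mwt (evw s) (odw s).

(** The first entry is to be balanced by the exponent of t, the second by the degree in x, phi or in
    ns; one pair thus encodes both weight identities. *)
Definition bwt (m : monomial) : int * int :=
  ((wgt true m)%:Z, (wgt true m)%:Z - (wgt false m)%:Z).

Lemma bwtM M p : factors M p -> bwt M = bwt p.1 + bwt p.2.
Proof.
move=> fp; have E s : wgt s M = (wgt s p.1 + wgt s p.2)%N by apply: mwt_factors.
by congr (_, _); rewrite /= !E !PoszD // opprD addrACA.
Qed.

Lemma bwt1 : bwt mon1 = 0.
Proof. by rewrite /bwt /wgt !mwt1. Qed.

Section Gradings.
Context (K : fieldType).
Local Notation xs := (series K xphi).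
Local Notation xc := (coefs K xphi).

(* The degree of t^k M phi^e x^n is [bwt M + dlr r (k, (n, e))], with [r = 1]
   for series in which x, phi stand for the components of K o H, and [r = 0]
   otherwise. *)
Definition dlr (r : int) (c : int * xphi) : int * int :=
  (c.1 + r * xdeg c.2, xdeg c.2).

Lemma dlrM r (a b c : int * xphi) :
  sb_mul a.2 b.2 = Some c.2 -> c.1 = a.1 + b.1 -> dlr r c = dlr r a + dlr r b.
Proof.
by move=> /xdegM E1 E2; congr (_, _); rewrite /= E1 ?E2 // mulrDr addrACA.
Qed.

Lemma dlr_one r k : dlr r (k, sb_one xphi) = (k, 0).
Proof. by rewrite /dlr /xdeg /= mulr0 addr0. Qed.

Local Notation xhomog r := (@homog K xphi _ bwt (dlr r)).

Lemma setT_div M p : factors M p -> [set: monomial] M -> [set: monomial] p.1 /\ [set: monomial] p.2.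
Proof. by []. Qed.

Lemma lt_div n M p : factors M p -> [set m | (mdg m < n)%N] M ->
  [set m | (mdg m < n)%N] p.1 /\ [set m | (mdg m < n)%N] p.2.
Proof. by move=> /mdg_factors /= ->; lia. Qed.

(** A scalar is lifted to a multiple of the unit, whose degree (k, 0) is the same for every [r];
    hence the condition does not mention [r]. *)
Definition scal_homog (S : set monomial) (q : int * int) (a : scalars K) :=
  forall m, S m -> forall k, k \in msupp (a m) -> bwt m + (k, 0) = q.

Lemma lift_xhomog r S q a : scal_homog S q a -> xhomog r S q (lift xphi a).
Proof. by move=> ha; apply: lift_homog => m Sm k /(ha _ Sm); rewrite dlr_one. Qed.

Lemma act_homog r S s q b (P : xc -> xc) (f : xs) :
  (forall g c, c \in msupp (P g) ->
     exists a, [/\ a \in msupp g, c.1 = a.1 & xdeg c.2 = xdeg a.2 + b]) ->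
  xhomog r S q f -> xhomog r S (q + (r * b, b)) (act s P f).
Proof.
move=> HP hf m Sm c /(fsubsetP (msuppZ_le _ _)) /HP [a [af E1 E2]].
rewrite -(hf m Sm a af) -addrA; congr (_ + _).
by rewrite /dlr E1 E2 mulrDr addrA.
Qed.

(** The factor t^(s (2n + e)) put on phi^e x^n is absorbed by lowering [r] by [s]. Thus [Hbar]
    passes from r = 1 to r = 0, and [F2bar] from r = 0 to r = 1. *)
Lemma tpow_homog S s r q (f : xs) :
  xhomog r S q f -> xhomog (r - s) S q (act false (tpow s) f).
Proof.
move=> hf m Sm c /(fsubsetP (msuppZ_le _ _)) /msupp_tpow [a [af E1 E2]].
rewrite -(hf m Sm a af); congr (_ + _); rewrite /dlr E1 E2.
by congr (_, _); ring.
Qed.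

Section VectorFields.
Context (r : int) (ix iy : nat -> int) (a b : nat -> scalars K).

Definition vf (f : xs) : xs :=
  ssum (fun i => actL (a i) (ix i) f + actG (b i) (iy i) f).

Lemma actL_homog S q p c j (f : xs) :
  (forall M p, factors M p -> S M -> S p.1 /\ S p.2) ->
  scal_homog S q c -> xhomog r S p f ->
  xhomog r S (q + (p + (r * (2 * j), 2 * j))) (actL c j f).
Proof.
move=> Sd hc hf; apply: (smul_homog bwtM (@dlrM r) Sd).
  exact: lift_xhomog.
by apply: act_homog hf => g d; apply: msupp_Lx.
Qed.

Lemma actG_homog S q p c j (f : xs) :
  (forall M p, factors M p -> S M -> S p.1 /\ S p.2) ->
  scal_homog S q c -> xhomog r S p f ->
  xhomog r S (q + (p + (r * (2 * j + 1), 2 * j + 1))) (actG c j f).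
Proof.
move=> Sd hc hf; apply: (smul_homog bwtM (@dlrM r) Sd).
  exact: lift_xhomog.
by apply: act_homog hf => g d; apply: msupp_Gx.
Qed.

(** Each coefficient has the degree opposite to the shift made by its L or G, so the vector field
    preserves degrees. The variables A, M satisfy this for r = 0, the variables B, N for r = 1. *)
Definition vf_scal_homog S :=
  (forall i, scal_homog S (- (r * (2 * ix i), 2 * ix i)) (a i)) /\
  (forall i, scal_homog S (- (r * (2 * iy i + 1), 2 * iy i + 1)) (b i)).

Lemma vf_homog S p (f : xs) :
  (forall M p, factors M p -> S M -> S p.1 /\ S p.2) ->
  vf_scal_homog S -> xhomog r S p f -> xhomog r S p (vf f).
Proof.
move=> Sd [ha hb] hf; apply: ssum_homog => i; apply: homogD.
  by have := actL_homog (j := ix i) Sd (ha i) hf; rewrite [p + _]addrC addKr.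
by have := actG_homog (j := iy i) Sd (hb i) hf; rewrite [p + _]addrC addKr.
Qed.

Hypothesis a1 : forall i, a i mon1 = 0.
Hypothesis b1 : forall i, b i mon1 = 0.

Lemma vf_raising : raising vf.
Proof.
move=> n g vg m mn; rewrite /vf /ssum fsbig1 // => i _; rewrite seriesD /actL /actG.
rewrite (smul_raising (lift_eq0 _ (a1 i)) (act_vanish false (Lx0 _ _) vg)) //.
by rewrite (smul_raising (lift_eq0 _ (b1 i)) (act_vanish true (Gx0 _ _) vg)) // addr0.
Qed.

Hypothesis afin : forall m, finite_set [set i | a i m != 0].
Hypothesis bfin : forall m, finite_set [set i | b i m != 0].

(** In a wrong bidegree no factorisation of [M] into two smaller monomials contributes, and (1, M)
    drops out since the coefficients have no constant term. There remain the coefficients at [M]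
    acting on y t^s x, through L_j x = - x^(j+1) and G_{j+1/2} x = phi x^(j+1). *)
Lemma mcoeff_vf M c p (f : xs) (y : K) (s : int) :
  vf_scal_homog [set m | (mdg m < mdg M)%N] ->
  xhomog r [set m | (mdg m < mdg M)%N] p f ->
  f mon1 = << y *g (s, ((1, false) : xphi)) >> ->
  bwt M + dlr r c != p ->
  (vf f M)@_c = \sum_(i \in [set: nat])
     ((if c.2 == (ix i + 1, false) then (a i M)@_(c.1 - s) * - y else 0) +
      (if c.2 == (iy i + 1, true) then (b i M)@_(c.1 - s) * y else 0)).
Proof.
move=> [ha hb] hf f1 bad; rewrite /vf /ssum raddf_fsum; last first.
  (* An index contributes only if [a i] or [b i] is nonzero at some divisor of [M]; local finiteness
     leaves finitely many of them. *)
  apply: (@sub_finite_set _ _ (\bigcup_(m in [set m | divides m M])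
     ([set i | a i m != 0] `|` [set i | b i m != 0]))); last first.
    apply: bigcup_finite => [|m _]; first exact: finite_divisors.
    by rewrite finite_setU.
  move=> i [_ ne]; apply: contrapT => nex; case/eqP: ne; rewrite seriesD.
  have H m m' : factors M (m, m') -> a i m = 0 /\ b i m = 0.
    move=> fm; split; apply: contrapT => /eqP n0; apply: nex; exists m;
      by [exists m' | left | right].
  rewrite /actL /actG !smul_eq0 ?addr0 // => -[m m'] /H [ai bi] /=; left;
    exact: lift_eq0.
apply: eq_fsbigr => i _.
transitivity ((actL (a i) (ix i) f M)@_c + (actG (b i) (iy i) f M)@_c).
  exact: mcoeffD.
have E1 := addKr (r * (2 * ix i), 2 * ix i) p.
have E2 := addKr (r * (2 * iy i + 1), 2 * iy i + 1) p.
have La := lift_xhomog r (ha i).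
have Lb := lift_xhomog r (hb i).
have Af := act_homog (b := 2 * ix i) (s := false) (@msupp_Lx K (ix i)) hf.
have Bf := act_homog (b := 2 * iy i + 1) (s := true) (@msupp_Gx K (iy i)) hf.
rewrite /actL /actG; congr (_ + _).
  apply: etrans (mcoeff_smul_lin bwtM (@dlrM r) (lift_eq0 _ (a1 i)) La Af _) _.
    by rewrite [p + _]addrC E1.
  by rewrite act_mon1 f1 Lx_x (mcoeff_cmul_lift (@xone_mul)).
apply: etrans (mcoeff_smul_lin bwtM (@dlrM r) (lift_eq0 _ (b1 i)) Lb Bf _) _.
  by rewrite [p + _]addrC E2.
by rewrite act_mon1 f1 Gx_x (mcoeff_cmul_lift (@xone_mul)).
Qed.

Lemma mcoeff_opexp_vf (e : K) M c :
  vf_scal_homog [set m | (mdg m < mdg M)%N] ->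
  (0 < mdg M)%N -> bwt M + dlr r c != (2 * r, 2) ->
  (opexp (fun g => e *: vf g) (scst K 0 ((1, false) : xphi)) M)@_c =
   e * \sum_(i \in [set: nat])
     ((if c.2 == (ix i + 1, false) then - (a i M)@_c.1 else 0) +
      (if c.2 == (iy i + 1, true) then (b i M)@_c.1 else 0)).
Proof.
move=> hab M0 bad; set x0 := scst _ _ _.
have h0 : xhomog r [set m | (mdg m < mdg M)%N] (2 * r, 2) x0.
  have -> : (2 * r, 2) = dlr r (0, ((1, false) : xphi)).
    by rewrite /dlr /xdeg /= add0r mulrC.
  by apply: scst_homog; apply: bwt1.
have hD g : xhomog r [set m | (mdg m < mdg M)%N] (2 * r, 2) g ->
    xhomog r [set m | (mdg m < mdg M)%N] (2 * r, 2) (e *: vf g).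
  by move=> hg; apply: homogZ; apply: vf_homog => //; apply: lt_div.
have rD := raisingZ e vf_raising.
have H2 g : xhomog r [set m | (mdg m < mdg M)%N] (2 * r, 2) g -> g mon1 = 0 ->
    ((e *: vf g) M)@_c = 0.
  (* A vanishing constant term is the case y = 0 of [mcoeff_vf]. This disposes of the terms of order
     at least 2 in the exponential. *)
  move=> hg g0; have g1 : g mon1 = << 0 *g (0, ((1, false) : xphi)) >>.
    by rewrite monalgU0.
  rewrite seriesZ mcoeffZ (mcoeff_vf hab hg g1 bad) fsbig1 ?mulr0 // => j _.
  by rewrite mulrN !mulr0 !oppr0 !if_same addr0.
rewrite mcoeff_opexp; first last.
- move=> i; rewrite iterS; apply: H2; first by apply: iter_homog.
  by rewrite iterS; apply: (raising_mon1 _ rD).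
- exact: rD.
have -> : x0 M = 0.
  by rewrite /x0 /scst; case: eqP => // M1; move: M0; rewrite M1 mdg1.
have x1 : x0 mon1 = << 1 *g (0, ((1, false) : xphi)) >> by rewrite /x0 /scst eqxx.
rewrite mcoeff0 add0r; apply: etrans (mcoeffZ e (vf x0 M) c) _; congr (_ * _).
rewrite (mcoeff_vf hab h0 x1 bad).
by apply: eq_fsbigr => j _; rewrite subr0 mulrN !mulr1.
Qed.

End VectorFields.

Lemma svar_homog S m : scal_homog S (bwt m) (svar K m).
Proof.
move=> M _ k; rewrite /svar; case: eqP => [->|_]; last by rewrite msupp0 inE.
by move=> /msupp_mono ->; rewrite -[RHS]addr0.
Qed.

Lemma bwt_even s i : bwt (mon_even (s, i)) =
  if s then (2 * i.+1%:Z, 2 * i.+1%:Z) else (0, - (2 * i.+1%:Z)).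
Proof. by rewrite /bwt /wgt !mwt_even /evw /=; case: s => /=; congr (_, _); lia. Qed.

Lemma bwt_odd s i : bwt (mon_odd (s, i)) =
  if s then (2 * i%:Z + 1, 2 * i%:Z + 1) else (0, - (2 * i%:Z + 1)).
Proof. by rewrite /bwt /wgt !mwt_odd /odw /=; case: s => /=; congr (_, _); lia. Qed.

Lemma xoneE : sb_one xphi = ((0, false) : xphi). Proof. by []. Qed.

Lemma sone_mon1 : sone K xphi mon1 = << (0, ((0, false) : xphi)) >>.
Proof. rewrite /sone xoneE /scst eqxx; exact: erefl. Qed.

(** * Powers and substitution of homogeneous superfunctions *)

Section Powers.
Context (h : xs) (hh : xhomog 0 setT (2, 2) h).
Hypothesis h1 : h mon1 = << (2, ((1, false) : xphi)) >>.

Lemma sone_homog : xhomog 0 setT 0 (sone K xphi).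
Proof.
have -> : 0 = dlr 0 (0, sb_one xphi) by rewrite dlr_one.
by apply: scst_homog; apply: bwt1.
Qed.

Lemma smul_h m w l n e :
  (pterm h w (mon1, m))@_(2 + l, ((1 + n, e) : xphi)) = (w m)@_(l, ((n, e) : xphi)).
Proof.
rewrite pterm_l1 h1.
(* The leading term t^2 x is even, so moving monomials past it costs no sign. *)
have -> : ctwist (mon_parity m) << (2, ((1, false) : xphi)) >> =
    << (1 : K) *g (2, ((1, false) : xphi)) >>.
  apply/malgP => c; rewrite mcoeff_ctwist mcoeffU.
  by case: eqP => [<-|_]; rewrite ?mulr0 // andbF expr0 mul1r.
rewrite (@mcoeff_mono_cmul _ xphi 1 (2, ((1, false) : xphi)) (w m) l
  ((n, e) : xphi) ((1 + n, e) : xphi)) ?mul1r //.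
by move=> [n' e'] /= [] /addrI -> ->.
Qed.

(* If h is invertible, h w = 1 determines the coefficients of w recursively;
   otherwise [sinv h = 0]. *)
Lemma sinv_homog : xhomog 0 setT (- 2, - 2) (sinv h).
Proof.
rewrite /sinv; case: xgetP => [w _ /= Hw|_]; last exact: homog0.
suff H n m : (mdg m < n)%N -> forall c, c \in msupp (w m) ->
    bwt m + dlr 0 c = (- 2, - 2) by move=> m _; apply: (H (mdg m).+1).
elim: n m => // n IH m mn [l [k e]]; rewrite -mcoeff_neq0 => wc.
apply: contrapT => bad; case/eqP: wc.
set c1 : int * xphi := (2 + l, ((1 + k, e) : xphi)).
have bad1 : bwt m + dlr 0 c1 <> 0.
  move=> E; apply: bad; move: E; rewrite /dlr /c1 /xdeg /= !mul0r !addr0.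
  by case: (bwt m) => x y [E1 E2]; congr (_, _) => /=; lia.
have <- : (smul h w m)@_c1 = (w m)@_(l, ((k, e) : xphi)).
  rewrite (mcoeff_smul1 (factors_l1 m)) ?smul_h // => p fp np; apply/negP => cp.
  case/msupp_pterm: (cp) => a [b [ap bp E1 E2]]; apply: bad1.
  rewrite (bwtM fp) (dlrM 0 E1 E2) addrACA (hh _ ap) // (IH _ _ _ bp) //.
  have := mdg_factors fp; have [/(factors_r0 fp)//|] := eqVneq (mdg p.2) (mdg m).
  by lia.
rewrite Hw; apply: mcoeff_outdom; apply/negP => /sone_homog.
by move=> /(_ I); apply: bad1.
Qed.

Lemma spow_homog n : xhomog 0 setT (2 * n, 2 * n) (spow h n).
Proof.
have H q k g : xhomog 0 setT q g -> xhomog 0 setT (q *+ k) (iter k (smul g) (sone K xphi)).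
  move=> hg; elim: k => [|k IH]; first exact: sone_homog.
  by rewrite mulrS; apply: (smul_homog bwtM (@dlrM 0)) => //; apply: setT_div.
have pM (x y : int) k : (x, y) *+ k = (x * k%:Z, y * k%:Z).
  elim: k => [|k IH]; first by rewrite !mulr0.
  by rewrite mulrS IH; congr (_, _) => /=; lia.
case: n => k /=.
  by rewrite -pM; apply: H.
rewrite (_ : (2 * Negz k, 2 * Negz k) = (- 2, - 2) *+ k.+1).
  exact: H sinv_homog.
by rewrite pM; congr (_, _); lia.
Qed.

(** The witness [u] is 1 if an inverse exists, and 0 if [sinv] takes its default value. *)
Lemma sinv_mon1 : exists u : K, sinv h mon1 = << u *g (- 2, ((- 1, false) : xphi)) >>.
Proof.
rewrite /sinv; case: xgetP => [w _ /= Hw|_]; last by exists 0; rewrite monalgU0.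
exists 1; apply/malgP => -[l [n e]].
rewrite -smul_h -(fsum_eq1 (F := pterm h w) (factors_l1 mon1)); last first.
  by move=> p /factors1.
rewrite -smulE Hw /sone /scst eqxx !mcoeffU !xpair_eqE.
by congr (_ *+ (nat_of_bool _)); apply/idP/idP; case: e => /=; lia.
Qed.

(* [u n] is 0 for n < 0 in case h is not invertible. *)
Lemma spow_mon1 : exists u : int -> K, (forall n, 0 <= n -> u n = 1) /\
  forall n, spow h n mon1 = << u n *g (2 * n, ((n, false) : xphi)) >>.
Proof.
have [u0 Hu0] := sinv_mon1.
exists (fun n => if n is Negz k then u0 ^+ k.+1 else 1); split; first by case.
have H (g : xs) (x : K) (k : nat) (s n : int) : g mon1 = << x *g (s, ((n, false) : xphi)) >> ->
    iter k (smul g) (sone K xphi) mon1 =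
    << x ^+ k *g (s * k%:Z, ((n * k%:Z, false) : xphi)) >>.
  move=> g1; elim: k => [|k IH].
    rewrite [iter _ _ _]/= sone_mon1 expr0 (mulr0 s) (mulr0 n).
    exact: erefl.
  rewrite iterS smul_mon1; apply: etrans (f_equal2 (@cmul K xphi) g1 IH) _.
  apply: etrans (cmul_mono2 _ _ _ _) _; rewrite /umul /= exprS.
  have E (z : int) : z + z * k%:Z = z * k.+1%:Z.
    by rewrite -[k.+1%:Z]/(1 + k%:Z) mulrDr mulr1.
  rewrite (E s) (E n); exact: erefl.
case=> k.
  rewrite /spow (H _ _ _ _ _ h1) expr1n (mul1r k%:Z); exact: erefl.
rewrite /spow (H _ _ _ _ _ Hu0).
have -> : - 2 * k.+1%:Z = 2 * Negz k by lia.
have -> : - 1 * k.+1%:Z = Negz k by lia.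
exact: erefl.
Qed.

End Powers.

Section Composition.
Context (h : xs * xs).
Hypothesis hh1 : xhomog 0 setT (2, 2) h.1.
Hypothesis hh2 : xhomog 0 setT (1, 1) h.2.
Hypothesis h1 : h.1 mon1 = << (2, ((1, false) : xphi)) >>.
Hypothesis h2 : h.2 mon1 = << (1, ((0, true) : xphi)) >>.

(** The degrees (2, 2) and (1, 1) of [h] for r = 0 are those of x and phi for r = 1. Substitution
    therefore turns the grading r = 1 into the grading r = 0. *)
Lemma ceval_homog q (f : xc) :
  (forall c, c \in msupp f -> dlr 1 c = q) -> xhomog 0 setT q (ceval h f).
Proof.
move=> hf; rewrite /ceval big_seq_cond; apply: big_ind.
- exact: homog0.
- by move=> ????; apply: homogD.
move=> [k [n e]]; rewrite andbT => af; apply: homogZ; rewrite /=.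
have -> : q = (k, 0) + ((if e then (1, 1) else 0) + (2 * n, 2 * n)).
  by rewrite -(hf _ af) /dlr /xdeg /=; case: e {af} => /=; congr (_, _) => /=; lia.
apply: (smul_homog bwtM (@dlrM 0)) => //.
  rewrite -(dlr_one 0); apply: scst_homog; exact: bwt1.
apply: (smul_homog bwtM (@dlrM 0)) => //.
  by case: e {af} => //; apply: sone_homog.
exact: spow_homog.
Qed.

Lemma scomp_term_homog q m (f : xc) :
  (forall c, c \in msupp f -> bwt m + dlr 1 c = q) ->
  xhomog 0 setT q (smul (lift xphi (svar K m)) (ceval h f)).
Proof.
move=> hf; have -> : q = bwt m + (q - bwt m) by rewrite addrC subrK.
apply: (smul_homog bwtM (@dlrM 0)) => //.
  by apply: lift_xhomog; apply: svar_homog.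
by apply: ceval_homog => c /hf <-; rewrite addrC addKr.
Qed.

Lemma scomp1_homog q (f : xs) : xhomog 1 setT q f -> xhomog 0 setT q (scomp1 f h).
Proof.
by move=> hf; apply: ssum_homog => m; apply: scomp_term_homog => c; apply: hf.
Qed.

Lemma cmul_one (f : xc) : cmul << (0, sb_one xphi) >> f = f.
Proof.
apply/malgP => -[l w]; rewrite -{1}[l]add0r.
rewrite (@mcoeff_mono_cmul _ xphi 1 (0, sb_one xphi) f l w w) ?mul1r ?xone_mul //.
by move=> w'; rewrite xone_mul => -[].
Qed.

Lemma scomp_term_eq0 m M (f : xs) : ~ divides m M ->
  smul (lift xphi (svar K m)) f M = 0.
Proof.
move=> nd; apply: smul_eq0 => -[m1 m2] fm; left; apply: lift_eq0.
by rewrite /svar; case: eqP => //= E; case: nd; exists m2; rewrite -E.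
Qed.

Lemma scomp_term_diag M (f : xs) :
  smul (lift xphi (svar K M)) f M = f mon1.
Proof.
have E : lift xphi (svar K M) M = << (0, sb_one xphi) >>.
  by apply: lift_mono; rewrite /svar eqxx.
rewrite smul_eq1; first by rewrite E cmul_one.
move=> [m m'] fm nm; left; apply: lift_eq0; rewrite /svar; case: eqP => // E1.
by case: nm; apply: factors_l0 => //; apply: congr1.
Qed.

(** A proper divisor m of [M] yields terms of degree [q], since [f] is homogeneous below [M] and [h]
    everywhere. In a wrong degree only m = M is left, and there [h] enters through its constant
    terms alone. *)
Lemma mcoeff_scomp1 q (f : xs) M c :
  xhomog 1 [set m | (mdg m < mdg M)%N] q f -> bwt M + dlr 0 c != q ->
  (scomp1 f h M)@_c = (ceval h (f M) mon1)@_c.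
Proof.
move=> hf bad; rewrite /scomp1 /ssum (raddf_fsum1 (h := mcoeff c) (i0 := M)) //=.
- by rewrite scomp_term_diag.
- apply: sub_finite_set (finite_divisors M) => m [_ /=].
  by apply: contra_neqP => nd; apply: scomp_term_eq0.
move=> m _ nm; have [[m' fm]|nd] := pselect (divides m M); last first.
  by rewrite scomp_term_eq0 ?mcoeff0.
apply: mcoeff_outdom; apply/negP => cm; case/eqP: bad.
apply: scomp_term_homog cm => // d; apply: hf => /=.
have [E|] := eqVneq (mdg m) (mdg M); last by have := mdg_factors fm => /=; lia.
by have [] := factors_l0 fm E.
Qed.

(** The constant terms substitute t^2 x for x and t phi for phi, so phi^e x^n gains t^(2n + e). The
    factor [u n] records the possible default value of [sinv]. *)
Lemma mcoeff_ceval_mon1 : exists u : int -> K, (forall n, 0 <= n -> u n = 1) /\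
  forall f k n e, (ceval h f mon1)@_(k, ((n, e) : xphi)) =
    u n * f@_(k - (2 * n + (e : nat)%:Z), ((n, e) : xphi)).
Proof.
have [u [u1 Hu]] := spow_mon1 h1; exists u; split=> // f k n e.
rewrite /ceval fct_sumE mcoeff_sum [in RHS](monalgE f) mcoeff_sum mulr_sumr.
apply: eq_bigr => -[l [n' e']] _.
pose g : xs := smul (if e' then h.2 else sone K xphi) (spow h.1 n').
have E1 : (if e' then h.2 else sone K xphi) mon1 =
    << ((e' : nat)%:Z, ((0, e') : xphi)) >>.
  by case: e' {g}; [exact: h2 | exact: sone_mon1].
have E2 : g mon1 = << u n' *g ((e' : nat)%:Z + 2 * n', ((n', e') : xphi)) >>.
  rewrite /g smul_mon1; apply: etrans (f_equal2 (@cmul K xphi) E1 (Hu n')) _.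
  apply: etrans (cmul_mono2 _ _ _ _) _.
  rewrite /umul /= andbF orbF (mul1r (u n')) (add0r n'); exact: erefl.
have E3 : scst K l (sb_one xphi) mon1 = << (l, ((0, false) : xphi)) >>.
  rewrite xoneE /scst eqxx; exact: erefl.
have E4 : smul (scst K l (sb_one xphi)) g mon1 =
    << u n' *g (l + ((e' : nat)%:Z + 2 * n'), ((n', e') : xphi)) >>.
  rewrite smul_mon1; apply: etrans (f_equal2 (@cmul K xphi) E3 E2) _.
  apply: etrans (cmul_mono2 _ _ _ _) _.
  rewrite /umul /= (mul1r (u n')) (add0r n'); exact: erefl.
transitivity (f@_(l, ((n', e') : xphi)) *
    (smul (scst K l (sb_one xphi)) g mon1)@_(k, ((n, e) : xphi))).
  exact: mcoeffZ.
rewrite E4 !mcoeffU !xpair_eqE.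
have -> : [&& l + ((e' : nat)%:Z + 2 * n') == k, n' == n & e' == e] =
   [&& l == k - (2 * n + (e : nat)%:Z), n' == n & e' == e].
  by case: (n' =P n) => [->|]; case: (e' =P e) => [->|];
    rewrite ?andbF ?andbT //; apply/eqP/eqP; lia.
case: and3P => [[_ /eqP -> _]|_]; last by rewrite !mulr0n !mulr0.
by rewrite !mulr1n mulrC.
Qed.

End Composition.

End Gradings.

(** * Homogeneity of Psi *)

Section PsiHomogeneity.
Context (K : fieldType).
Local Notation xs := (series K xphi).
Local Notation xhomog r := (@homog K xphi _ bwt (dlr r)).
Local Notation x0 := (scst K 0 ((1, false) : xphi)).
Local Notation phi0 := (scst K 0 ((0, true) : xphi)).

Lemma svar_mon1 m : (0 < mdg m)%N -> svar K m mon1 = 0.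
Proof. by rewrite /svar; case: eqP => // <-; rewrite mdg1. Qed.

Lemma vA1 i : vA K i mon1 = 0. Proof. by apply: svar_mon1; rewrite /mdg mwt_even. Qed.
Lemma vB1 i : vB K i mon1 = 0. Proof. by apply: svar_mon1; rewrite /mdg mwt_even. Qed.
Lemma vM1 i : vM K i mon1 = 0. Proof. by apply: svar_mon1; rewrite /mdg mwt_odd. Qed.
Lemma vN1 i : vN K i mon1 = 0. Proof. by apply: svar_mon1; rewrite /mdg mwt_odd. Qed.

Lemma scst_mon1 k (w : xphi) : scst K k w mon1 = << (k, w) >>.
Proof. rewrite /scst eqxx; exact: erefl. Qed.

Lemma x0_homog r S : xhomog r S (2 * r, 2) x0.
Proof.
have -> : (2 * r, 2) = dlr r (0, ((1, false) : xphi)).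
  by rewrite /dlr /xdeg /= add0r mulrC.
by apply: scst_homog; apply: bwt1.
Qed.

Lemma phi0_homog r S : xhomog r S (r, 1) phi0.
Proof.
have -> : (r, 1) = dlr r (0, ((0, true) : xphi)).
  by rewrite /dlr /xdeg /= add0r mulr0 add0r mulr1.
by apply: scst_homog; apply: bwt1.
Qed.

Section PosNeg.
Context (a b : nat -> scalars K).

Lemma vf_posE : vf_pos a b = vf (fun i => i.+1%:Z) (fun i => i%:Z) a b.
Proof. by []. Qed.

Lemma vf_negE : vf_neg a b = vf (fun i => - i.+1%:Z) (fun i => - i.+1%:Z) a b.
Proof. by []. Qed.
End PosNeg.

Lemma AM_homog : vf_scal_homog 0 (fun i => i.+1%:Z) (fun i => i%:Z) (@vA K) (@vM K) setT.
Proof.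
split=> i.
  rewrite (_ : - _ = bwt (mon_even (false, i))); first exact: svar_homog.
  by rewrite bwt_even; congr (_, _); rewrite /= ?mul0r ?oppr0.
rewrite (_ : - _ = bwt (mon_odd (false, i))); first exact: svar_homog.
by rewrite bwt_odd; congr (_, _); rewrite /= ?mul0r ?oppr0.
Qed.

Lemma BN_homog :
  vf_scal_homog 1 (fun i => - i.+1%:Z) (fun i => - i.+1%:Z) (@vB K) (@vN K) setT.
Proof.
split=> i.
  rewrite (_ : - _ = bwt (mon_even (true, i))); first exact: svar_homog.
  by rewrite bwt_even; congr (_, _) => /=; lia.
rewrite (_ : - _ = bwt (mon_odd (true, i))); first exact: svar_homog.
by rewrite bwt_odd; congr (_, _) => /=; lia.
Qed.

Local Notation H := (Hbar K).
Local Notation KK := (Kbar K).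

Lemma opexp_vf_homog r S q e ix iy (a b : nat -> scalars K) f :
  (forall M p, factors M p -> S M -> S p.1 /\ S p.2) ->
  vf_scal_homog r ix iy a b S -> xhomog r S q f ->
  xhomog r S q (opexp (fun g => e *: vf ix iy a b g) f).
Proof.
move=> Sd hab hf; apply: opexp_homog => // g hg; apply: homogZ.
exact: vf_homog.
Qed.

Lemma oppr_vf ix iy (a b : nat -> scalars K) :
  (fun g : xs => - vf ix iy a b g) = (fun g => (-1) *: vf ix iy a b g).
Proof. by apply/funext => g; rewrite scaleN1r. Qed.

Lemma id_vf ix iy (a b : nat -> scalars K) :
  vf ix iy a b = (fun g => 1 *: vf ix iy a b g).
Proof. by apply/funext => g; rewrite scale1r. Qed.

Lemma H1_homog : xhomog 0 setT (2, 2) H.1.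
Proof.
rewrite /Hbar /at_xphi /= vf_posE oppr_vf; apply: opexp_vf_homog => //.
  exact: AM_homog.
have := tpow_homog (s := 1) (@x0_homog 1 setT); rewrite subrr mulr1; exact.
Qed.

Lemma H2_homog : xhomog 0 setT (1, 1) H.2.
Proof.
rewrite /Hbar /at_xphi /= vf_posE oppr_vf; apply: opexp_vf_homog => //.
  exact: AM_homog.
have := tpow_homog (s := 1) (@phi0_homog 1 setT); rewrite subrr; exact.
Qed.

Lemma K1_homog : xhomog 1 setT (2, 2) KK.1.
Proof.
rewrite /Kbar /at_xphi /= vf_negE oppr_vf; apply: opexp_vf_homog => //.
  exact: BN_homog.
have := @x0_homog 1 setT; rewrite mulr1; exact.
Qed.

Lemma K2_homog : xhomog 1 setT (1, 1) KK.2.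
Proof.
rewrite /Kbar /at_xphi /= vf_negE oppr_vf; apply: opexp_vf_homog => //.
  exact: BN_homog.
exact: (@phi0_homog 1 setT).
Qed.

Lemma H1_mon1 : H.1 mon1 = << (2, ((1, false) : xphi)) >>.
Proof.
rewrite /Hbar /at_xphi /= opexp_mon1; last first.
  exact/raisingN/vf_raising/vM1/vA1.
rewrite act_mon1 scst_mon1 tpow_mono; exact: erefl.
Qed.

Lemma H2_mon1 : H.2 mon1 = << (1, ((0, true) : xphi)) >>.
Proof.
rewrite /Hbar /at_xphi /= opexp_mon1; last first.
  exact/raisingN/vf_raising/vM1/vA1.
rewrite act_mon1 scst_mon1 tpow_mono; exact: erefl.
Qed.

Lemma K1_mon1 : KK.1 mon1 = << (0, ((1, false) : xphi)) >>.
Proof.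
rewrite /Kbar /at_xphi /= opexp_mon1; last first.
  exact/raisingN/vf_raising/vN1/vB1.
exact: scst_mon1.
Qed.

Lemma K2_mon1 : KK.2 mon1 = << (0, ((0, true) : xphi)) >>.
Proof.
rewrite /Kbar /at_xphi /= opexp_mon1; last first.
  exact/raisingN/vf_raising/vN1/vB1.
exact: scst_mon1.
Qed.

Lemma scomp1_mon1 (h : xs * xs) f : scomp1 f h mon1 = ceval h (f mon1) mon1.
Proof.
rewrite /scomp1 /ssum (fsum_eq1 (i0 := mon1)) //; first exact: scomp_term_diag.
move=> m _ nm; apply: scomp_term_eq0 => -[m' /factors1 [E _]].
by apply: nm.
Qed.

Local Notation KH := (scomp KK H).

Lemma KH1_homog : xhomog 0 setT (2, 2) KH.1.
Proof.
exact: (scomp1_homog H1_homog H2_homog H1_mon1 K1_homog).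
Qed.

Lemma KH2_homog : xhomog 0 setT (1, 1) KH.2.
Proof.
exact: (scomp1_homog H1_homog H2_homog H1_mon1 K2_homog).
Qed.

Lemma KH1_mon1 : KH.1 mon1 = << (2, ((1, false) : xphi)) >>.
Proof.
have [u [u1 Hu]] := mcoeff_ceval_mon1 H1_mon1 H2_mon1.
have E : KH.1 mon1 = ceval H (KK.1 mon1) mon1 by exact: scomp1_mon1.
apply/malgP => -[k [n e]]; rewrite E K1_mon1 Hu.
rewrite !mcoeffU !xpair_eqE.
case: (1 =P n) => [<-|]; last by rewrite !andbF mulr0.
by rewrite u1 // mul1r; case: e; rewrite ?andbF //=; congr (_ *+ nat_of_bool _); lia.
Qed.

Lemma KH2_mon1 : KH.2 mon1 = << (1, ((0, true) : xphi)) >>.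
Proof.
have [u [u1 Hu]] := mcoeff_ceval_mon1 H1_mon1 H2_mon1.
have E : KH.2 mon1 = ceval H (KK.2 mon1) mon1 by exact: scomp1_mon1.
apply/malgP => -[k [n e]]; rewrite E K2_mon1 Hu.
rewrite !mcoeffU !xpair_eqE.
case: (0 =P n) => [<-|]; last by rewrite !andbF mulr0.
by rewrite u1 // mul1r; case: e; rewrite ?andbF //=; congr (_ *+ nat_of_bool _); lia.
Qed.

Lemma mcoeff_actL (a : scalars K) (j r : int) M c p (f : xs) (y : K) (s : int) :
  a mon1 = 0 ->
  scal_homog [set m | (mdg m < mdg M)%N] (- (r * (2 * j), 2 * j)) a ->
  xhomog r [set m | (mdg m < mdg M)%N] p f ->
  f mon1 = << y *g (s, ((1, false) : xphi)) >> ->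
  bwt M + dlr r c != p ->
  (actL a j f M)@_c =
     if c.2 == (j + 1, false) then (a M)@_(c.1 - s) * - y else 0.
Proof.
move=> a1 ha hf f1 bad.
have La := lift_xhomog r ha.
have Af := act_homog (b := 2 * j) (s := false) (@msupp_Lx K j) hf.
apply: etrans (mcoeff_smul_lin bwtM (@dlrM r) (lift_eq0 _ a1) La Af _) _.
  by rewrite [p + _]addrC addKr.
by rewrite act_mon1 f1 Lx_x (mcoeff_cmul_lift (@xone_mul)).
Qed.

(** * The sewing equation at one monomial, in a wrong bidegree *)

Section Step.
Context (Psi : int -> scalars K) (hPsi : is_Psi Psi) (M : monomial).
Hypothesis M0 : (0 < mdg M)%N.
Local Notation S := [set m | (mdg m < mdg M)%N].
Hypothesis IH : forall p, scal_homog S (0, - p) (Psi p).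

Lemma even_pos1 i : even_pos Psi i mon1 = 0.
Proof. by case: hPsi => _ + _ _; apply. Qed.
Lemma odd_pos1 i : odd_pos Psi i mon1 = 0.
Proof. by case: hPsi => _ + _ _; apply. Qed.
Lemma even_neg1 i : even_neg Psi i mon1 = 0.
Proof. by case: hPsi => _ + _ _; apply. Qed.
Lemma odd_neg1 i : odd_neg Psi i mon1 = 0.
Proof. by case: hPsi => _ + _ _; apply. Qed.

Lemma Psi_fin (f : nat -> int) : injective f ->
  forall m, finite_set [set i | Psi (f i) m != 0].
Proof.
move=> injf m; case: hPsi => /(_ m) fin _ _ _.
apply: (@finite_preimage _ _ [set p | Psi p m != 0] f); last exact: fin.
by move=> ? ? _ _; apply: injf.
Qed.

Lemma even_pos_fin m : finite_set [set i | even_pos Psi i m != 0].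
Proof. by apply: (@Psi_fin (fun i => 2 * i.+1%:Z)) => i j; lia. Qed.
Lemma odd_pos_fin m : finite_set [set i | odd_pos Psi i m != 0].
Proof. by apply: (@Psi_fin (fun i => 2 * i.+1%:Z - 1)) => i j; lia. Qed.
Lemma even_neg_fin m : finite_set [set i | even_neg Psi i m != 0].
Proof. by apply: (@Psi_fin (fun i => - (2 * i.+1%:Z))) => i j; lia. Qed.
Lemma odd_neg_fin m : finite_set [set i | odd_neg Psi i m != 0].
Proof. by apply: (@Psi_fin (fun i => - (2 * i.+1%:Z) + 1)) => i j; lia. Qed.

Lemma Psi_pos_homog :
  vf_scal_homog 0 (fun i => i.+1%:Z) (fun i => i%:Z) (even_pos Psi) (odd_pos Psi) S.
Proof.
split=> i.
  rewrite (_ : - _ = (0, - (2 * i.+1%:Z))); first exact: IH.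
  by congr (_, _) => /=; lia.
rewrite (_ : - _ = (0, - (2 * i.+1%:Z - 1))); first exact: IH.
by congr (_, _) => /=; lia.
Qed.

Lemma Psi_neg_homog :
  vf_scal_homog 0 (fun i => - i.+1%:Z) (fun i => - i.+1%:Z)
    (even_neg Psi) (odd_neg Psi) S.
Proof.
split=> i.
  rewrite (_ : - _ = (0, - - (2 * i.+1%:Z))); first exact: IH.
  by congr (_, _) => /=; lia.
rewrite (_ : - _ = (0, - (- (2 * i.+1%:Z) + 1))); first exact: IH.
by congr (_, _) => /=; lia.
Qed.

Variables (k : int) (w : xphi).
Hypothesis bad : bwt M + dlr 0 (k, w) != (0, 2).

Lemma bad0 : bwt M + dlr 0 (k, w) != (2 * 0, 2).
Proof. by rewrite mulr0. Qed.

Lemma mcoeff_F1 : ((F1bar Psi).1 M)@_(k, w) = \sum_(i \in [set: nat])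
  ((if w == (- i.+1%:Z + 1, false) then - (even_neg Psi i M)@_k else 0) +
   (if w == (- i.+1%:Z + 1, true) then (odd_neg Psi i M)@_k else 0)).
Proof.
rewrite /F1bar /at_xphi [fst _]/= vf_negE id_vf.
rewrite (mcoeff_opexp_vf even_neg1 odd_neg1 even_neg_fin odd_neg_fin 1
  Psi_neg_homog M0 bad0).
by rewrite mul1r.
Qed.

Local Notation E1 :=
  (opexp (fun g => - vf_pos (even_pos Psi) (odd_pos Psi) g) x0).
Local Notation D2 := (fun g => - (2 : K) *: actL (Psi 0) 0 g).
Local Notation g2 := (act false (tpow (- 1)) E1).

Lemma E1_homog : xhomog 0 S (0, 2) E1.
Proof.
rewrite vf_posE oppr_vf; apply: opexp_vf_homog.
- exact: lt_div.
- exact: Psi_pos_homog.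
- by have := @x0_homog 0 S; rewrite mulr0.
Qed.

Lemma g2_homog : xhomog 1 S (0, 2) g2.
Proof.
have := tpow_homog (s := - 1) E1_homog.
by rewrite sub0r opprK.
Qed.

Lemma Psi0_homog : scal_homog S (- (1 * (2 * 0), 2 * 0)) (Psi 0).
Proof.
by have := @IH 0; rewrite (_ : (0, - 0) = - (1 * (2 * 0), 2 * 0)).
Qed.

Lemma D2_homog g : xhomog 1 S (0, 2) g -> xhomog 1 S (0, 2) (D2 g).
Proof.
move=> hg; apply: homogZ.
have := actL_homog (j := 0) (@lt_div (mdg M)) Psi0_homog hg.
by rewrite [_ + (1 * _, _)]addrC addKr.
Qed.

Lemma Psi01 : Psi 0 mon1 = 0.
Proof. by case: hPsi => _ + _ _; apply. Qed.

Lemma D2_raising : raising D2.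
Proof.
apply: raisingZ => n g vg m mn; rewrite /actL.
exact: (smul_raising (lift_eq0 _ Psi01) (act_vanish false (Lx0 _ _) vg)).
Qed.

Lemma F2_homog : xhomog 1 S (0, 2) (F2bar Psi).1.
Proof.
rewrite /F2bar /at_xphi [fst _]/=; apply: opexp_homog.
  exact: D2_homog.
exact: g2_homog.
Qed.

Lemma E1_mon1 : E1 mon1 = << (0, ((1, false) : xphi)) >>.
Proof.
rewrite opexp_mon1; first exact: scst_mon1.
exact/raisingN/vf_raising/odd_pos1/even_pos1.
Qed.

Lemma g2_mon1 : g2 mon1 =
  << 1 *g (0 + - 1 * xdeg ((1, false) : xphi), ((1, false) : xphi)) >>.
Proof. rewrite act_mon1 E1_mon1 tpow_mono; exact: erefl. Qed.

(** The place in [F2bar] that the substitution of t^2 x and t phi moves to [(k, w)]. *)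
Local Notation c' := (k + - 1 * xdeg w, w).

Lemma bad1 : bwt M + dlr 1 c' != (0, 2).
Proof.
rewrite (_ : dlr 1 c' = dlr 0 (k, w)) // /dlr /=; congr (_, _).
by rewrite mulN1r mul1r mul0r addrNK addr0.
Qed.

Lemma mcoeff_F2 : ((F2bar Psi).1 M)@_c' = - \sum_(i \in [set: nat])
  ((if w == (i.+1%:Z + 1, false) then - (even_pos Psi i M)@_k else 0) +
   (if w == (i%:Z + 1, true) then (odd_pos Psi i M)@_k else 0))
  + (if w == (1, false) then 2 * (Psi 0 M)@_k else 0).
Proof.
have H2 g y s : xhomog 1 S (0, 2) g ->
    g mon1 = << y *g (s, ((1, false) : xphi)) >> ->
    (D2 g M)@_c' = - 2 * (if w == (1, false) then
        (Psi 0 M)@_(k + - 1 * xdeg w - s) * - y else 0).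
  move=> hg g1; rewrite seriesZ mcoeffZ; congr (_ * _).
  by rewrite (mcoeff_actL Psi01 Psi0_homog hg g1 bad1).
rewrite /F2bar /at_xphi [fst _]/= mcoeff_opexp; first last.
(* Iterates of order at least 2 apply [D2] to a series with constant term 0, that is, with y = 0. *)
- move=> i; rewrite iterS (H2 _ 0 0).
  + by rewrite mulrN mulr0 !oppr0 if_same mulr0.
  + by apply: iter_homog; [exact: D2_homog | exact: g2_homog].
  + by rewrite monalgU0 iterS; apply: raising_mon1 D2_raising.
- exact: D2_raising.
congr (_ + _); last first.
  (* The constant term of [g2] is t^(-2) x. Its exponent cancels the shift of [c'] when [w] is x, so
     [Psi 0] is read at [k]. *)
  rewrite (H2 _ _ _ g2_homog g2_mon1).
  case: eqP => [->|_]; last by rewrite mulr0.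
  by rewrite add0r addrK mulrN mulr1 mulrNN.
rewrite /act andFb expr0 scale1r mcoeff_tpow vf_posE oppr_vf.
rewrite (mcoeff_opexp_vf even_pos1 odd_pos1 even_pos_fin odd_pos_fin (- 1)
  Psi_pos_homog M0 bad0).
by rewrite mulN1r.
Qed.

Lemma mcoeff_F1F2 : exists u : K, (0 <= w.1 -> u = 1) /\
  ((F1bar Psi).1 M)@_(k, w) = u * ((F2bar Psi).1 M)@_c'.
Proof.
have [u [u1 Hu]] := mcoeff_ceval_mon1 KH1_mon1 KH2_mon1.
exists (u w.1); split; first exact: u1.
have -> : F1bar Psi = scomp (F2bar Psi) KH by case: hPsi.
have E : ((scomp (F2bar Psi) KH).1 M)@_(k, w) =
    (ceval KH ((F2bar Psi).1 M) mon1)@_(k, w).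
  exact: (mcoeff_scomp1 KH1_homog KH2_homog KH1_mon1 F2_homog bad).
rewrite E; clear E; case: w => n e /=; rewrite Hu.
by congr (_ * _); congr (_@_(_, _)); rewrite /xdeg /= mulN1r.
Qed.

(** In a wrong bidegree, x^n and phi x^n come only from F^(2) if n >= 1 and only from F^(1) if n <=
    0. Each of them stems from a single Psi_p, since L or G of doubled degree p sends x to an
    element of degree p + 2. For n >= 1 one has u = 1; for n <= 0 the factor u multiplies 0. *)
Lemma Psi_step p : (2 : K) != 0 -> p = xdeg w - 2 -> (Psi p M)@_k = 0.
Proof.
move=> n2 pE; have [u [u1]] := mcoeff_F1F2; rewrite mcoeff_F1 mcoeff_F2.
move: u1 pE; case: w => n e /=; rewrite /xdeg /= => u1 pE.
have [n1|n1] := leP 1 n.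
  rewrite u1 ?mul1r; last by lia.
  rewrite fsbig1; last first.
    by move=> i _; rewrite !ifF ?addr0 //; apply/negP; case/andP=> /eqP /=; lia.
  case: e pE => pE.
    rewrite (fsum_eq1 (i0 := `|n - 1|%N)) //; last first.
      move=> i _ ni; rewrite !ifF ?addr0 //; apply/negP; case/andP=> /eqP /=; lia.
    rewrite ifF; last by apply/negP; case/andP.
    rewrite ifT; last by apply/andP; split=> //; apply/eqP => /=; lia.
    rewrite ifF; last by apply/negP; case/andP.
    rewrite add0r addr0 /odd_pos => /eqP.
    rewrite eq_sym oppr_eq0 (_ : 2 * _ - 1 = p); last by lia.
    by move/eqP.
  (* The element x itself comes from exp(- 2 Psi_0 L_0), hence with coefficient 2 Psi_0; here 2 must
     be invertible. *)
  have [n1'|n1'] := eqVneq n 1.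
    rewrite fsbig1; last first.
      by move=> i _; rewrite !ifF ?addr0 //; apply/negP; case/andP=> /eqP /=; lia.
    rewrite ifT; last by apply/andP; split=> //; apply/eqP.
    rewrite oppr0 add0r (_ : p = 0); last by lia.
    by move/esym/eqP; rewrite mulf_eq0 (negPf n2) => /eqP.
  rewrite (fsum_eq1 (i0 := `|n - 2|%N)) //; last first.
    move=> i _ ni; rewrite !ifF ?addr0 //; apply/negP; case/andP=> /eqP /=; lia.
  rewrite ifT; last by apply/andP; split=> //; apply/eqP => /=; lia.
  rewrite ifF; last by apply/negP; case/andP.
  rewrite ifF; last by apply/negP; case/andP=> /eqP /=; lia.
  rewrite !addr0 opprK /even_pos (_ : 2 * _ = p); last by lia.
  by move/esym.
rewrite [X in _ = u * (- X + _)]fsbig1; last first.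
  by move=> i _; rewrite !ifF ?addr0 //; apply/negP; case/andP=> /eqP /=; lia.
rewrite ifF; last by apply/negP; case/andP=> /eqP /=; lia.
rewrite oppr0 addr0 mulr0 (fsum_eq1 (i0 := `|n|%N)) //; last first.
  move=> i _ ni; rewrite !ifF ?addr0 //; apply/negP; case/andP=> /eqP /=; lia.
case: e pE => pE.
  rewrite ifF; last by apply/negP; case/andP.
  rewrite ifT; last by apply/andP; split=> //; apply/eqP => /=; lia.
  by rewrite add0r /odd_neg (_ : - _ + 1 = p); last by lia.
rewrite ifT; last by apply/andP; split=> //; apply/eqP => /=; lia.
rewrite ifF; last by apply/negP; case/andP.
rewrite addr0 /even_neg (_ : - (2 * _) = p); last by lia.
by move/eqP; rewrite oppr_eq0 => /eqP.
Qed.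

End Step.

Lemma Psi_homog (Psi : int -> scalars K) :
  (2 : K) != 0 -> is_Psi Psi -> forall p, scal_homog setT (0, - p) (Psi p).
Proof.
move=> n2 hPsi.
suff H n : forall p, scal_homog [set m | (mdg m < n)%N] (0, - p) (Psi p).
  by move=> p m _; apply: (H (mdg m).+1) => /=.
elim: n => [|n IH] p m //= mn k km.
have [m0|m0] := posnP (mdg m).
  move: km; rewrite (mdg_eq0 m0); case: hPsi => _ /(_ p) E _ _.
  by rewrite E msupp0 inE.
apply/eqP; apply: contraTT km => bad; rewrite -mcoeff_eq0; apply/eqP.
(* The basis element to which Psi_p sends x: x^(p/2 + 1) for even p, phi x^((p+1)/2) for odd p. *)
pose w : xphi := ((p %/ 2)%Z + 1, (p %% 2)%Z == 1).
have pE : p = xdeg w - 2.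
  rewrite /xdeg /=; have := divz_eq p 2; have := @modz_ge0 p 2 isT.
  by have := @ltz_pmod p 2 isT; case: eqP => /=; lia.
apply: (Psi_step hPsi m0 _ (w := w)) => //.
  by move=> q m' /= m'm; apply: IH => /=; lia.
apply: contraNN bad => /eqP; rewrite /dlr /= mul0r addr0 => E.
rewrite -subr_eq0; apply/eqP.
have -> : bwt m + (k, 0) - (0, - p) = bwt m + (k, xdeg w) - (0, 2).
  by case: (bwt m) => x y; congr (_, _) => /=; lia.
by rewrite E subrr.
Qed.

End PsiHomogeneity.

(** Every variable has positive weight in one of the two systems, so a bound on both weights bounds
    the indices as well as the exponents. *)
Lemma finite_wgt (N : nat) : finite_set [set m | forall s, (wgt s m <= N)%N].
Proof.
pose s := [seq (x, i) | x <- [:: true; false], i <- iota 0 N].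
apply: (@sub_finite_set _ _ _ _ (@finite_monomials (seq_fset tt (s : seq evar)) N
  (seq_fset tt (s : seq ovar)))).
have sP x i : (i < N)%N -> (x, i) \in s.
  by move=> iN; apply/allpairsP; exists (x, i); rewrite mem_iota; case: x.
move=> m mN.
have E v : v \in finsupp m.1 -> (m.1 v * (2 * v.2.+1) <= N)%N.
  move=> vm; apply: leq_trans (mN v.1); rewrite /wgt /mwt (big_fsetD1 v) //=.
  by rewrite /evw eqxx -addnA leq_addr.
have P v : v \in finsupp m.1 -> (0 < m.1 v)%N.
  by rewrite -cmE_neq0 lt0n.
split.
- apply/fsubsetP => v vm; rewrite seq_fsetE; have := E v vm; have := P v vm.
  by case: v {vm} => x i /= m0 Hi; apply: sP; nia.
- move=> v; have [vm|] := boolP (v \in finsupp m.1).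
    by have := E v vm; nia.
  by rewrite -cmE_eq0 => /eqP ->.
- apply/fsubsetP => v vm.
  have : ((2 * v.2).+1 <= N)%N.
    apply: leq_trans (mN v.1); rewrite /wgt /mwt [X in (_ + X)%N](big_fsetD1 v) //=.
    by rewrite {1}/odw eqxx addnCA leq_addr.
  by rewrite seq_fsetE; case: v {vm} => x i /= Hi; apply: sP; lia.
Qed.

(** In doubled weights, bidegree (0, - p) means k = - wB and wA = wB + p. So k <= 0, and k
    determines both weights. *)
Lemma scal_homog_polynomial (K : fieldType) (f : scalars K) p :
  scal_homog setT (0, - p) f -> polynomial_power_series f.
Proof.
move=> hf; have H m k : (f m)@_k != 0 ->
    k = - (wgt true m)%:Z /\ (wgt false m)%:Z = (wgt true m)%:Z + p.
  rewrite mcoeff_neq0 => /(hf m I); rewrite /bwt => -[].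
  set x := (wgt true m)%:Z; set y := (wgt false m)%:Z => E1 E2.
  by split; lia.
split=> [m k k0|k].
  by apply/eqP; apply: contraTT k0 => /H [-> _]; lia.
apply: (@sub_finite_set _ _ _ _ (finite_wgt (`|k| + `|p|)%N)).
by move=> m /= /H [E1 E2] []; lia.
Qed.

(** * A module over the Neveu-Schwarz algebra with d <> 0 *)

Section Representation.
Context (K : fieldType).
Hypotheses (n2 : (2 : K) != 0) (n3 : (3 : K) != 0).

(* [inl j] is v_{j/2}, [inr false] is u and [inr true] is w.  The action is
     L_m w = (m^2 + m) v_m,     G_r w = - (2 r + 1) v_r,     d w = 24 u,
     L_m v_n = - (m + n) v_{m+n} + delta_{m+n,0} (m + 1) u,
     L_m v_s = - (s + m/2) v_{m+s},
     G_r v_n = v_{r+n},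
     G_r v_s = - (r + s) v_{r+s} + delta_{r+s,0} (2 r + 1) u
   for m, n integers and r, s half-integers; P_i projects onto the degree - i.
   [gact g v x] is the coefficient of g v at the basis element x. *)
Definition nsmod := (int + bool)%type.
Implicit Types (v : nsmod -> K) (x : nsmod).

Definition isodd (i : int) : bool := (i %% 2)%Z == 1.

Definition coefL (m i : int) : K := - ((i + (if isodd i then m else 2 * m))%:~R / 2).
Definition coefG (m i : int) : K := if isodd i then - ((2 * m + 1 + i)%:~R / 2) else 1.

Definition gact (g : ns_gen) v x : K :=
  match g, x with
  | Gen_d, inr false => 24 * v (inr true)
  | Gen_L m, inl j => coefL m (j - 2 * m) * v (inl (j - 2 * m))
      + (j == 2 * m)%:R * ((m ^+ 2 + m)%:~R * v (inr true))
  | Gen_L m, inr false => (m + 1)%:~R * v (inl (- (2 * m)))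
  | Gen_G m, inl j => coefG m (j - (2 * m + 1)) * v (inl (j - (2 * m + 1)))
      - (j == 2 * m + 1)%:R * ((2 * m + 2)%:~R * v (inr true))
  | Gen_G m, inr false => (2 * m + 2)%:~R * v (inl (- (2 * m + 1)))
  | Gen_P i, inl j => (j == - i)%:R * v x
  | Gen_P i, inr _ => (i == 0)%:R * v x
  | _, _ => 0
  end.

Definition wact (a : seq ns_gen) v : nsmod -> K := foldr gact v a.

Lemma gact_sum (I : Type) (s : seq I) g (c : I -> K) (f : I -> nsmod -> K) x :
  gact g (fun y => \sum_(i <- s) c i * f i y) x = \sum_(i <- s) c i * gact g (f i) x.
Proof.
elim: s x => [|i s IH] x.
  rewrite big_nil; case: g => [|m|m|m] /=; case: x => [j|[]] //=;
    by rewrite ?big_nil ?mulr0 ?addr0 ?subr0.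
rewrite big_cons -IH; case: g {IH} => [|m|m|m] /=; case: x => [j|[]] //=;
  rewrite ?big_cons ?mulr0 ?addr0 //; ring.
Qed.

Lemma wact_sum (I : Type) (s : seq I) a (c : I -> K) (f : I -> nsmod -> K) x :
  wact a (fun y => \sum_(i <- s) c i * f i y) x = \sum_(i <- s) c i * wact a (f i) x.
Proof.
elim: a x => //= g a IH x; rewrite -gact_sum; congr (gact g _ x).
exact/funext.
Qed.

Definition rho (f : ns_free K) v x : K := mmap idfun (fun a : {fmonom ns_gen} => wact a v x) f.

Lemma rhoE f v x : rho f v x = \sum_(a <- msupp f) f@_a * wact a v x.
Proof. by []. Qed.

Lemma rhoD f h v x : rho (f + h) v x = rho f v x + rho h v x.
Proof. exact: mmapD. Qed.
Lemma rhoB f h v x : rho (f - h) v x = rho f v x - rho h v x.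
Proof. exact: mmapB. Qed.
Lemma rho0 v x : rho 0 v x = 0.
Proof. exact: mmap0. Qed.

Lemma rhoZ c f v x : rho (c *: f) v x = c * rho f v x.
Proof.
rewrite /rho (mmapEw (msuppZ_le c f)) mmapE mulr_sumr.
by apply: eq_bigr => a _; rewrite mcoeffZ mulrA.
Qed.

Lemma rho_word (c : K) a v x : rho << c *g a >> v x = c * wact a v x.
Proof. exact: mmapU. Qed.

Lemma wactM (a b : {fmonom ns_gen}) v : wact (mmul a b) v = wact a (wact b v).
Proof. by rewrite /wact fmM foldr_cat. Qed.

Lemma rhoM f h v x : rho (f * h) v x = rho f (rho h v) x.
Proof.
rewrite malgME /rho raddf_sum /= mmapE; apply: eq_bigr => a _.
rewrite raddf_sum /= -[X in _ = _ * wact a X x]/(fun y => \sum_(b <- msupp h) h@_b * wact b v y).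
rewrite wact_sum mulr_sumr; apply: eq_bigr => b _.
by rewrite mmapU wactM mulrA.
Qed.

Lemma rho_gen g v : rho << fmu g >> v = gact g v.
Proof. by apply/funext => x; rewrite rho_word mul1r /wact fmU. Qed.

Lemma isoddD i m : isodd (i + 2 * m) = isodd i.
Proof. by rewrite /isodd; apply/eqP/eqP; lia. Qed.

Lemma isoddD1 i m : isodd (i + (2 * m + 1)) = ~~ isodd i.
Proof. by rewrite /isodd; case: eqP => ?; case: eqP => ? //=; lia. Qed.

Local Notation gen g := (<< fmu g >> : ns_free K).

Lemma rho_mul g h v x : rho (gen g * gen h) v x = gact g (gact h v) x.
Proof. by rewrite rhoM (rho_gen h) (rho_gen g). Qed.

Lemma rho_comm g h v x : rho (gen g * gen h - gen h * gen g) v x =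
  gact g (gact h v) x - gact h (gact g v) x.
Proof.
exact: etrans (rhoB _ _ _ _)
  (f_equal2 _ (rho_mul _ _ _ _) (congr1 _ (rho_mul _ _ _ _))).
Qed.

Lemma rho_anticomm g h v x : rho (gen g * gen h + gen h * gen g) v x =
  gact g (gact h v) x + gact h (gact g v) x.
Proof. exact: etrans (rhoD _ _ _ _) (f_equal2 _ (rho_mul _ _ _ _) (rho_mul _ _ _ _)). Qed.

Lemma rho_scale c g v x : rho (c *: gen g) v x = c * gact g v x.
Proof. by rewrite rhoZ (rho_gen g). Qed.

Lemma rho_lin c g d h v x : rho (c *: gen g + d *: gen h) v x =
  c * gact g v x + d * gact h v x.
Proof. exact: etrans (rhoD _ _ _ _) (f_equal2 _ (rho_scale _ _ _ _) (rho_scale _ _ _ _)). Qed.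

Lemma rho_rel a b v x : UP_rel a b -> rho a v x = rho b v x.
Proof.
have n12 : (12 : K) != 0.
  have -> : (12 : K) = 2 * 2 * 3 by ring.
  by rewrite !mulf_neq0.
case=> {a b} [m n|m n|m n|n|n|i j|i m|i m|i].
- apply: etrans (rho_comm (Gen_L m) (Gen_L n) v x)
    (etrans _ (esym (rho_lin _ (Gen_L (m + n)) _ Gen_d v x))).
  case: x => [j|[]] /=.
  (* With j written as i plus the degree of the bracket, every Kronecker delta becomes the condition
     i = 0, which singles out the contribution of w. *)
  + have [i ->] : exists i, j = i + 2 * (m + n) by exists (j - 2 * (m + n)); ring.
    rewrite (_ : i + 2 * (m + n) - 2 * m = i + 2 * n); last by ring.
    rewrite (_ : i + 2 * (m + n) - 2 * n = i + 2 * m); last by ring.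
    rewrite !addrK /coefL !isoddD.
    rewrite (_ : (_ == 2 * n) = (i == 0)); last by apply/eqP/eqP; lia.
    rewrite (_ : (i + 2 * m == 2 * m) = (i == 0)); last by apply/eqP/eqP; lia.
    rewrite (_ : (_ == 2 * (m + n)) = (i == 0)); last by apply/eqP/eqP; lia.
    case: (i =P 0) => [->|_] /=; first by field; rewrite ?n12 ?n2 ?n3.
    by case: (isodd i) => /=; field; rewrite ?n12 ?n2 ?n3.
  + by ring.
  + rewrite (_ : - (2 * m) - 2 * n = - (2 * (m + n))); last by ring.
    rewrite (_ : - (2 * n) - 2 * m = - (2 * (m + n))); last by ring.
    rewrite (_ : (- (2 * m) == 2 * n) = (m + n == 0)); last by apply/eqP/eqP; lia.
    rewrite (_ : (- (2 * n) == 2 * m) = (m + n == 0)); last by apply/eqP/eqP; lia.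
    rewrite /coefL (_ : isodd _ = false); last by rewrite /isodd; apply/negP => /eqP; lia.
    case: eqP => [mn|_] /=; last by field; rewrite ?n12 ?n2 ?n3.
    have -> : n = - m by lia.
    by rewrite /=; field; rewrite ?n12 ?n2 ?n3.
- apply: etrans (rho_comm (Gen_G m) (Gen_L n) v x)
    (etrans _ (esym (rho_scale _ (Gen_G (m + n)) v x))).
  case: x => [j|[]] /=.
  + have [i ->] : exists i, j = i + (2 * (m + n) + 1) by exists (j - (2 * (m + n) + 1)); ring.
    rewrite (_ : i + (2 * (m + n) + 1) - (2 * m + 1) = i + 2 * n); last by ring.
    rewrite (_ : i + (2 * (m + n) + 1) - 2 * n = i + (2 * m + 1)); last by ring.
    rewrite !addrK /coefL /coefG !isoddD !isoddD1.
    rewrite (_ : (i + 2 * n == 2 * n) = (i == 0)); last by apply/eqP/eqP; lia.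
    rewrite (_ : (i + (2 * m + 1) == 2 * m + 1) = (i == 0)); last by apply/eqP/eqP; lia.
    rewrite (_ : (i + (2 * (m + n) + 1) == 2 * (m + n) + 1) = (i == 0)); last by apply/eqP/eqP; lia.
    case: (i =P 0) => [->|_] /=; first by field; rewrite ?n12 ?n2 ?n3.
    by case: (isodd i) => /=; field; rewrite ?n12 ?n2 ?n3.
  + by ring.
  + rewrite (_ : - (2 * m + 1) - 2 * n = - (2 * (m + n) + 1)); last by ring.
    rewrite (_ : - (2 * n) - (2 * m + 1) = - (2 * (m + n) + 1)); last by ring.
    rewrite (_ : (- (2 * m + 1) == 2 * n) = false); last by apply/negP => /eqP; lia.
    rewrite (_ : (- (2 * n) == 2 * m + 1) = false); last by apply/negP => /eqP; lia.
    rewrite /coefL /coefG (_ : isodd _ = true); last by rewrite /isodd; apply/eqP; lia.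
    by rewrite /=; field; rewrite ?n12 ?n2 ?n3.
- apply: etrans (rho_anticomm (Gen_G m) (Gen_G (n - 1)) v x)
    (etrans _ (esym (rho_lin _ (Gen_L (m + n)) _ Gen_d v x))).
  case: x => [j|[]] /=.
  + have [i ->] : exists i, j = i + 2 * (m + n) by exists (j - 2 * (m + n)); ring.
    rewrite (_ : i + 2 * (m + n) - (2 * m + 1) = i + (2 * (n - 1) + 1)); last by ring.
    rewrite (_ : i + 2 * (m + n) - (2 * (n - 1) + 1) = i + (2 * m + 1)); last by ring.
    rewrite !addrK /coefL /coefG !isoddD1.
    rewrite (_ : (i + (2 * (n - 1) + 1) == _) = (i == 0)); last by apply/eqP/eqP; lia.
    rewrite (_ : (i + (2 * m + 1) == 2 * m + 1) = (i == 0)); last by apply/eqP/eqP; lia.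
    rewrite (_ : (i + 2 * (m + n) == 2 * (m + n)) = (i == 0)); last by apply/eqP/eqP; lia.
    rewrite (_ : (i + 2 * (m + n) == 2 * m + 1) = (i + 2 * n == 1)); last by apply/eqP/eqP; lia.
    rewrite (_ : (i + 2 * (m + n) == _) = (i + 2 * m == -1)); last by apply/eqP/eqP; lia.
    rewrite !mulr0 !subr0.
    case: (i =P 0) => [->|_] /=; first by field; rewrite ?n12 ?n2 ?n3.
    by case: (isodd i) => /=; field; rewrite ?n12 ?n2 ?n3.
  + by ring.
  + rewrite (_ : - (2 * m + 1) - (2 * (n - 1) + 1) = - (2 * (m + n))); last by ring.
    rewrite (_ : - (2 * (n - 1) + 1) - (2 * m + 1) = - (2 * (m + n))); last by ring.
    rewrite (_ : (- (2 * m + 1) == _) = (m + n == 0)); last by apply/eqP/eqP; lia.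
    rewrite (_ : (- (2 * (n - 1) + 1) == _) = (m + n == 0)); last by apply/eqP/eqP; lia.
    rewrite /coefG (_ : isodd _ = false); last by rewrite /isodd; apply/negP => /eqP; lia.
    case: eqP => [mn|_] /=; last by field; rewrite ?n12 ?n2 ?n3.
    (* Both products contribute 4 m (m+1) times the coordinate of w, and 8 (m^2 + m) = 24 (m^2 +
       m)/3: the value 24 also fits the odd relation. *)
    have -> : n = - m by lia.
    by rewrite /=; field; rewrite ?n12 ?n2 ?n3.
- apply: etrans (rho_mul Gen_d (Gen_L n) v x)
    (etrans _ (esym (rho_mul (Gen_L n) Gen_d v x))).
  by case: x => [j|[]] /=; rewrite ?mulr0 ?addr0.
- apply: etrans (rho_mul Gen_d (Gen_G n) v x)
    (etrans _ (esym (rho_mul (Gen_G n) Gen_d v x))).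
  by case: x => [j|[]] /=; rewrite ?mulr0 ?subr0.
- apply: etrans (rho_mul (Gen_P i) (Gen_P j) v x) (etrans _ (esym (rho_scale _ (Gen_P i) v x))).
  have [<-|nij] := eqVneq i j.
    by case: x => [l|c] /=; case: eqP => _ /=; ring.
  case: x => [l|c] /=.
    case: (l =P - i) => [li|_]; case: (l =P - j) => [lj|_] /=; try ring.
    by case/eqP: nij; lia.
  case: (i =P 0) => [i0|_]; case: (j =P 0) => [j0|_] /=; try ring.
  by case/eqP: nij; lia.
- apply: etrans (rho_mul (Gen_P i) (Gen_L m) v x)
    (etrans _ (esym (rho_mul (Gen_L m) (Gen_P (i + 2 * m)) v x))).
  case: x => [j|[]] /=.
  + rewrite (_ : (j - 2 * m == _) = (j == - i)); last by apply/eqP/eqP; lia.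
    by case: (j =P - i) => E1; case: (j =P 2 * m) => E2;
      case: (i + 2 * m =P 0) => E3 /=; try ring; exfalso; lia.
  + exact: mulr0.
  + rewrite (_ : (_ == - (i + 2 * m)) = (i == 0)); last by apply/eqP/eqP; lia.
    by ring.
- apply: etrans (rho_mul (Gen_P i) (Gen_G (m - 1)) v x)
    (etrans _ (esym (rho_mul (Gen_G (m - 1)) (Gen_P (i + 2 * m - 1)) v x))).
  case: x => [j|[]] /=.
  + rewrite (_ : (_ == - (i + 2 * m - 1)) = (j == - i)); last by apply/eqP/eqP; lia.
    by case: (j =P - i) => E1; case: (j =P 2 * (m - 1) + 1) => E2;
      case: (i + 2 * m - 1 =P 0) => E3 /=; try ring; exfalso; lia.
  + exact: mulr0.
  + rewrite (_ : (_ == - (i + 2 * m - 1)) = (i == 0)); last by apply/eqP/eqP; lia.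
    by ring.
- apply: etrans (rho_mul (Gen_P i) Gen_d v x)
    (etrans _ (esym (rho_mul Gen_d (Gen_P i) v x))).
  case: x => [j|[]] /=; ring.
Qed.
End Representation.

(** * Homogeneity of Gamma *)

Section Gamma.
Context (K : fieldType).
Hypotheses (n2 : (2 : K) != 0) (n3 : (3 : K) != 0).
Local Notation ns := (series K ns_words).
Local Notation nc := (coefs K ns_words).

Lemma wact0 a x : wact a (fun=> 0 : K) x = 0.
Proof.
have -> : (fun=> 0) = (fun y : nsmod =>
    \sum_(i <- [::] : seq nat) (0 : K) * (fun _ _ => 0 : K) i y).
  by apply/funext => y; rewrite big_nil.
by rewrite wact_sum big_nil.
Qed.

Lemma rho_ideal a : UP_ideal a -> forall v x, rho a v x = 0 :> K.
Proof.
elim=> {a} [a b ab||a b _ IHa _ IHb|c a _ IH|c a _ IH] v x.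
- by rewrite rhoB (rho_rel n2 n3 v x ab) subrr.
- exact: rho0.
- by rewrite rhoD IHa IHb addr0.
- rewrite rhoM (_ : rho a v = (fun=> 0)); last by apply/funext => y; apply: IH.
  by rewrite rhoE big1 // => b _; rewrite wact0 mulr0.
- by rewrite rhoM IH.
Qed.

Lemma rho_UP_eq a b v x : UP_eq a b -> rho a v x = rho b v x :> K.
Proof. by move=> /rho_ideal /(_ v x) /eqP; rewrite rhoB subr_eq0 => /eqP. Qed.

Definition gdeg (g : ns_gen) : int :=
  match g with Gen_L m => 2 * m | Gen_G m => 2 * m + 1 | _ => 0 end.
Definition wdeg (a : ns_words) : int :=
  \sum_(g <- (a : {fmonom ns_gen}) : seq ns_gen) gdeg g.

Lemma wdegM (a b : ns_words) : wdeg (mmul (a : {fmonom ns_gen}) b) = wdeg a + wdeg b.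
Proof. by rewrite /wdeg fmM big_cat. Qed.
Lemma wdegU g : wdeg (fmu g) = gdeg g.
Proof. by rewrite /wdeg fmU big_seq1. Qed.
Lemma wdeg1 : wdeg (mone : {fmonom ns_gen}) = 0.
Proof. by rewrite /wdeg fm1 big_nil. Qed.

(** With u and w in degree 0 both cocycles preserve degrees, so every word acts homogeneously. *)
Definition bdeg (x : nsmod) : int := if x is inl j then j else 0.
Definition concentrated (d : int) (v : nsmod -> K) := forall x, bdeg x <> d -> v x = 0.

Lemma gact_concentrated d g v : concentrated d v -> concentrated (d + gdeg g) (gact g v).
Proof.
move=> cv x; case: g x => [|m|m|i] [j|[]] //= nd.
- by rewrite cv ?mulr0 //= => E; apply: nd; rewrite -E addr0.
- rewrite (cv (inl _)) ?mulr0 ?add0r /=; last by move=> E; apply: nd; rewrite -E subrK.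
  case: eqP => [E|_] /=; last by rewrite mul0r.
  by rewrite (cv (inr true)) ?mulr0 // => E'; apply: nd; rewrite E -E' add0r.
- by rewrite cv ?mulr0 //= => E; apply: nd; rewrite -E addNr.
- rewrite (cv (inl _)) ?mulr0 ?sub0r /=; last by move=> E; apply: nd; rewrite -E subrK.
  case: eqP => [E|_] /=; last by rewrite mul0r oppr0.
  by rewrite (cv (inr true)) ?mulr0 ?oppr0 // => E'; apply: nd; rewrite E -E' add0r.
- by rewrite cv ?mulr0 //= => E; apply: nd; rewrite -E addNr.
- by rewrite cv ?mulr0 //= => E; apply: nd; rewrite -E addr0.
- by rewrite cv ?mulr0 //= => E; apply: nd; rewrite -E addr0.
- by rewrite cv ?mulr0 //= => E; apply: nd; rewrite -E addr0.
Qed.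

Lemma wact_concentrated d (a : ns_words) v : concentrated d v -> concentrated (d + wdeg a) (wact (a : {fmonom ns_gen}) v).
Proof.
rewrite /wdeg; elim: (fmonom_val a) => [|g s IH] cv /=.
  by rewrite big_nil addr0.
by rewrite big_cons [gdeg g + _]addrC addrA; apply/gact_concentrated/IH.
Qed.

Lemma gactP_concentrated d i v : concentrated d v -> gact (Gen_P i) v = if d == - i then v else fun=> 0.
Proof.
move=> cv; apply/funext => x /=.
have -> : (match x with inl j => (j == - i)%:R * v x | inr _ => (i == 0)%:R * v x end)
    = (bdeg x == - i)%:R * v x.
  case: x => [j|b] //=; rewrite (_ : (0 == - i) = (i == 0)) //.
  by apply/eqP/eqP; lia.
have [E|nd] := eqVneq (bdeg x) d; last first.
  have vx : v x = 0 by apply: cv; apply/eqP.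
  by case: ifP => _; rewrite vx mulr0.
by rewrite E; case: eqP => _; rewrite ?mul1r ?mul0r.
Qed.

Definition topv (x : nsmod) : K := (x == inr true)%:R.

Lemma topv_concentrated : concentrated 0 topv.
Proof. by move=> [j|[]] //=; rewrite /topv. Qed.

(** The matrix coefficient between w and u. Through [rho] it is compatible with the quotient
    U_P(ns), it vanishes on words of nonzero degree, and it detects d. *)
Definition lam (a : ns_words) : K := wact (a : {fmonom ns_gen}) topv (inr false).

Lemma lam_deg a : wdeg a != 0 -> lam a = 0.
Proof.
move=> na; apply: (@wact_concentrated 0 a topv topv_concentrated) => /= E.
by move: na; rewrite -[wdeg a]add0r -E.
Qed.

Lemma lam_d : lam (fmu Gen_d) = 24.
Proof. by rewrite /lam /wact fmU /= /topv mulr1. Qed.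

(** P_i projects onto degree - i, while b w has degree [wdeg b]. For the term P_p t^(-p) of t^{-2
    L_0} this ties the exponent of t to the degree of the right factor. *)
Lemma lam_P (a b : {fmonom ns_gen}) i : wdeg b <> - i ->
  lam (mmul a (mmul (fmu (Gen_P i)) b)) = 0.
Proof.
move=> nb; rewrite /lam !wactM {2}/wact fmU /=.
rewrite (gactP_concentrated i (@wact_concentrated 0 b topv topv_concentrated)) ifF; last first.
  by apply/negP => /eqP E; apply: nb; rewrite -E add0r.
exact: wact0.
Qed.

Lemma lam_P0 (b : {fmonom ns_gen}) : lam (mmul (fmu (Gen_P 0)) b) = lam b.
Proof. by rewrite /lam wactM {1}/wact fmU /= mul1r. Qed.

Definition Lam (k : int) (f : nc) : K :=
  mmap idfun (fun c : int * ns_words => if c.1 == k then lam c.2 else 0) f.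

Lemma LamE k (f : nc) : rho (tcoef k f : ns_free K) topv (inr false) = Lam k f.
Proof.
rewrite /tcoef /rho raddf_sum /= /Lam mmapE big_mkcond /=; apply: eq_bigr => c _.
by case: eqP => _; rewrite ?mulr0 // mmapU.
Qed.

Lemma Lam_eq0 k (f : nc) : (forall c, c \in msupp f -> c.1 = k -> lam c.2 = 0) -> Lam k f = 0.
Proof.
move=> H; rewrite /Lam mmapE big_seq big1 // => c cf /=.
by case: eqP => [/(H _ cf) ->|_]; rewrite mulr0.
Qed.

HB.instance Definition _ k := GRing.Additive.copy (Lam k)
  (mmap idfun (fun c : int * ns_words => if c.1 == k then lam c.2 else 0)).

Definition dlw (r : int) (c : int * ns_words) : int * int :=
  (c.1 + r * wdeg c.2, wdeg c.2).

Lemma dlwM r (a b c : int * ns_words) :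
  sb_mul a.2 b.2 = Some c.2 -> c.1 = a.1 + b.1 -> dlw r c = dlw r a + dlw r b.
Proof.
by move=> [/= E1] E; rewrite /dlw -E1 wdegM E; congr (_, _); rewrite /= mulrDr addrACA.
Qed.

Lemma nsone_mul (w : ns_words) : sb_mul (sb_one ns_words) w = Some w.
Proof. by rewrite /= mul1m. Qed.

Local Notation nhomog r := (@homog K ns_words _ bwt (dlw r)).

Lemma dlw_one r k : dlw r (k, sb_one ns_words) = (k, 0).
Proof. by rewrite /dlw /= wdeg1 mulr0 addr0. Qed.

Lemma term_homog r S q c g :
  (forall M p, factors M p -> S M -> S p.1 /\ S p.2) ->
  scal_homog S q c -> nhomog r S (q + (r * gdeg g, gdeg g)) (term c g).
Proof.
move=> Sd hc; apply: (smul_homog bwtM (@dlwM r) Sd).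
  by apply: lift_homog => m Sm k /(hc _ Sm); rewrite dlw_one.
have -> : (r * gdeg g, gdeg g) = dlw r (0, (fmu g : ns_words)).
  by rewrite /dlw /= wdegU add0r.
by apply: scst_homog; apply: bwt1.
Qed.

Lemma term_mon1 (c : scalars K) g : c mon1 = 0 -> term c g mon1 = 0.
Proof.
move=> c0; rewrite /term smul_mon1; have -> := lift_eq0 ns_words c0.
exact: cmul0f.
Qed.

Definition ns_vf (ix iy : nat -> int) (a b : nat -> scalars K) : ns :=
  ssum (fun i : nat => term (a i) (Gen_L (ix i)) + term (b i) (Gen_G (iy i))).

Lemma ns_vf_homog r S ix iy a b :
  (forall M p, factors M p -> S M -> S p.1 /\ S p.2) ->
  vf_scal_homog r ix iy a b S -> nhomog r S 0 (ns_vf ix iy a b).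
Proof.
move=> Sd [ha hb]; apply: ssum_homog => i; apply: homogD.
  by rewrite -[0](addNr (r * (2 * ix i), 2 * ix i)); apply: term_homog.
by rewrite -[0](addNr (r * (2 * iy i + 1), 2 * iy i + 1)); apply: term_homog.
Qed.

Lemma ns_vf_mon1 ix iy (a b : nat -> scalars K) :
  (forall i, a i mon1 = 0) -> (forall i, b i mon1 = 0) -> ns_vf ix iy a b mon1 = 0.
Proof.
move=> a0 b0; rewrite /ns_vf /ssum fsbig1 // => i _.
by rewrite seriesD !term_mon1 // addr0.
Qed.

Lemma nsexp_homog r S u :
  (forall M p, factors M p -> S M -> S p.1 /\ S p.2) ->
  nhomog r S 0 u -> nhomog r S 0 (sexp u).
Proof.
move=> Sd; apply: (sexp_homog bwtM (@dlwM r) Sd); first exact: bwt1.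
by rewrite dlw_one.
Qed.

(** A grading that sees t alone, used with weight 0 on monomials: the exponentials in A, M and in B,
    N are free of t, so t enters only through the inserted t^(-p). *)
Definition tdeg (c : int * ns_words) : int := c.1.
Local Notation thomog := (@homog K ns_words int (fun=> 0) tdeg setT 0).

Lemma zero_wtM M (p : monomial * monomial) : factors M p -> (0 : int) = 0 + 0.
Proof. by rewrite addr0. Qed.

Lemma tdegM (a b c : int * ns_words) :
  sb_mul a.2 b.2 = Some c.2 -> c.1 = a.1 + b.1 -> tdeg c = tdeg a + tdeg b.
Proof. by []. Qed.

Lemma ns_vf_thomog ix iy (a b : nat -> scalars K) :
  (forall i m k, k \in msupp (a i m) -> k = 0) ->
  (forall i m k, k \in msupp (b i m) -> k = 0) -> thomog (ns_vf ix iy a b).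
Proof.
have H (c : scalars K) g : (forall m k, k \in msupp (c m) -> k = 0) -> thomog (term c g).
  move=> hc; rewrite -[X in homog _ _ _ X](addr0 (0 : int)).
  apply: (smul_homog zero_wtM tdegM (S := setT)) => //.
    by apply: lift_homog => m _ k /hc ->.
  have E : (0 : int) = tdeg (0, (fmu g : ns_words)) by [].
  by rewrite {2}E; apply: scst_homog.
by move=> ha hb; apply: ssum_homog => i; apply: homogD; apply: H;
  [exact: ha | exact: hb].
Qed.

Lemma nsexp_thomog u : thomog u -> thomog (sexp u).
Proof.
by move=> hu; apply: (sexp_homog zero_wtM tdegM (S := setT)).
Qed.

Lemma svar_supp m M k : k \in msupp (svar K m M) -> k = 0.
Proof.
rewrite /svar; case: eqP => _; last by rewrite msupp0 inE.
exact: msupp_mono.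
Qed.

Definition expAM : ns := sexp (- ns_pos (@vA K) (@vM K)).
Definition expBN : ns := sexp (- ns_neg (@vB K) (@vN K)).

Lemma expAM_homog : nhomog 0 setT 0 expAM.
Proof.
apply: nsexp_homog => //; apply: homogN.
exact: (@ns_vf_homog 0 setT (fun i => i.+1%:Z) (fun i => i%:Z)) (AM_homog K).
Qed.

Lemma expBN_homog : nhomog 1 setT 0 expBN.
Proof.
apply: nsexp_homog => //; apply: homogN.
exact: (@ns_vf_homog 1 setT (fun i => - i.+1%:Z) (fun i => - i.+1%:Z)) (BN_homog K).
Qed.

Lemma expAM_thomog : thomog expAM.
Proof.
apply: nsexp_thomog; apply: homogN.
apply: (@ns_vf_thomog (fun i => i.+1%:Z) (fun i => i%:Z)) => i m k; exact: svar_supp.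
Qed.

Lemma expBN_thomog : thomog expBN.
Proof.
apply: nsexp_thomog; apply: homogN.
apply: (@ns_vf_thomog (fun i => - i.+1%:Z) (fun i => - i.+1%:Z)) => i m k; exact: svar_supp.
Qed.

Definition insP (p : int) (g : ns) : ns :=
  smul (scst K (- p) (fmu (Gen_P p) : ns_words)) g.

Lemma msupp_insP p g M c : c \in msupp (insP p g M) ->
  exists2 b, b \in msupp (g M) &
    c = (- p + b.1, (mmul (fmu (Gen_P p)) (b.2 : {fmonom ns_gen}) : ns_words)).
Proof.
case/msupp_smul => -[m1 m2] [a [b [fM /= + bg]]].
rewrite {1}/scst; case: eqP => [m11|_]; last by rewrite msupp0 inE.
move: fM bg; rewrite m11 => /factors_inj2 <- bg.
move/msupp_mono => -> [E2] E1; exists b => //.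
by case: c E1 E2 => c1 c2 /= -> <-.
Qed.

Lemma msupp_around f p g M c : c \in msupp (smul f (insP p g) M) ->
  exists m a b, [/\ factors M m, a \in msupp (f m.1), b \in msupp (g m.2),
    c.1 = a.1 + (- p + b.1) &
    c.2 = mmul (a.2 : {fmonom ns_gen}) (mmul (fmu (Gen_P p)) (b.2 : {fmonom ns_gen}))].
Proof.
case/msupp_smul => m [a [d [fM am /msupp_insP [b bm ->] [E2] E1]]].
by exists m, a, b; split.
Qed.

(** A word not killed by [lam] has wdeg wa + wdeg wb = 0 and wdeg wb = - p. As k = - p, adding the
    bidegrees of the two exponentials gives bwt M + (k, 0) = 0, against [bad]. *)
Lemma around_AB M k : bwt M + (k, 0) != (0, 0) ->
  rho (around_tL0 expAM expBN M k) topv (inr false) = 0 :> K.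
Proof.
move=> bad; apply: (raddf_fsum0 (h := mmap idfun _)) => p _; move: (p : int) => {}p.
apply: etrans (LamE k (smul expAM (insP p expBN) M)) _; apply: Lam_eq0 => c.
case/msupp_around => m [[ka wa] [[kb wb] [fM am bm -> ->]]] /= ck.
have Ha := expAM_homog I am; have Hb := expBN_homog I bm.
have Ta := expAM_thomog I am; have Tb := expBN_thomog I bm.
apply/eqP; apply: contraNT bad => nz.
have d0 : wdeg (mmul (wa : {fmonom ns_gen})
    (mmul (fmu (Gen_P p)) (wb : {fmonom ns_gen})) : ns_words) = 0.
  by apply/eqP; apply: contraNT nz => /lam_deg /eqP.
have dp : wdeg wb = - p.
  by apply: contrapT => nb; case/eqP: nz; apply: lam_P.
move: d0; rewrite !wdegM wdegU /= add0r => d0.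
rewrite (bwtM fM); move: Ha Hb Ta Tb; rewrite /dlw /tdeg /=.
case: (bwt m.1) => x1 y1; case: (bwt m.2) => x2 y2.
rewrite mul0r mul1r !add0r => -[A1 A2] [B1 B2] T1 T2.
by apply/eqP; congr (_, _) => /=; lia.
Qed.

(** * The defining equation of Gamma at one monomial, in a wrong bidegree *)

Section Step.
Context (Psi : int -> scalars K) (Gam : scalars K).
Hypothesis hPsi : is_Psi Psi.
Hypothesis hGam : is_Gamma Psi Gam.
Context (M : monomial) (k : int).
Hypothesis M0 : (0 < mdg M)%N.
Local Notation S := [set m | (mdg m < mdg M)%N].
Hypothesis IH : scal_homog S (0, 0) Gam.
Hypothesis bad : bwt M + (k, 0) != (0, 0).

Let expPsi : ns := smul (sexp (ns_neg (even_neg Psi) (odd_neg Psi)))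
  (smul (sexp (ns_pos (even_pos Psi) (odd_pos Psi)))
    (sexp ((2 : K) *: term (Psi 0) (Gen_L 0)))).
Let Gam_d : ns := term Gam Gen_d.
Let expGam : ns := sexp Gam_d.

Lemma Psi_pos_homogT : vf_scal_homog 0 (fun i => i.+1%:Z) (fun i => i%:Z)
  (even_pos Psi) (odd_pos Psi) setT.
Proof.
have H := Psi_homog n2 hPsi; split=> i.
  rewrite (_ : - _ = (0, - (2 * i.+1%:Z))); first exact: H.
  by congr (_, _) => /=; lia.
rewrite (_ : - _ = (0, - (2 * i.+1%:Z - 1))); first exact: H.
by congr (_, _) => /=; lia.
Qed.

Lemma Psi_neg_homogT : vf_scal_homog 0 (fun i => - i.+1%:Z) (fun i => - i.+1%:Z)
  (even_neg Psi) (odd_neg Psi) setT.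
Proof.
have H := Psi_homog n2 hPsi; split=> i.
  rewrite (_ : - _ = (0, - - (2 * i.+1%:Z))); first exact: H.
  by congr (_, _) => /=; lia.
rewrite (_ : - _ = (0, - (- (2 * i.+1%:Z) + 1))); first exact: H.
by congr (_, _) => /=; lia.
Qed.

Lemma expPsi_homog : nhomog 0 setT 0 expPsi.
Proof.
rewrite -[0 in X in homog _ _ _ X](addr0 (0 : int * int)).
apply: (smul_homog bwtM (@dlwM 0)) => //.
  apply: nsexp_homog => //.
  exact: (@ns_vf_homog 0 setT (fun i => - i.+1%:Z) (fun i => - i.+1%:Z)) Psi_neg_homogT.
rewrite -[0 in X in homog _ _ _ X](addr0 (0 : int * int)).
apply: (smul_homog bwtM (@dlwM 0)) => //.
  apply: nsexp_homog => //.
  exact: (@ns_vf_homog 0 setT (fun i => i.+1%:Z) (fun i => i%:Z)) Psi_pos_homogT.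
apply: nsexp_homog => //; apply: homogZ.
have := @term_homog 0 setT (0, - 0) (Psi 0) (Gen_L 0) (@setT_div) (Psi_homog n2 hPsi (p := 0)).
by rewrite (_ : (0, - 0) + _ = 0).
Qed.

Lemma nsone_mon1 : sone K ns_words mon1 = << (0, sb_one ns_words) >>.
Proof. rewrite /sone /scst eqxx; exact: erefl. Qed.

Lemma expPsi_mon1 : expPsi mon1 = << (0, sb_one ns_words) >>.
Proof.
have one2 : cmul << (0, sb_one ns_words) >> << (0, sb_one ns_words) >> =
    << (0, sb_one ns_words) >> :> nc.
  apply: etrans (cmul_mono2 _ _ _ _) _; rewrite /umul /= mul1m mul1r; exact: erefl.
have e1 : sexp (ns_neg (even_neg Psi) (odd_neg Psi)) mon1 = << (0, sb_one ns_words) >>.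
  apply: sexp_mon1; apply: (@ns_vf_mon1 (fun i => - i.+1%:Z) (fun i => - i.+1%:Z)).
    exact: even_neg1.
  exact: odd_neg1.
have e2 : sexp (ns_pos (even_pos Psi) (odd_pos Psi)) mon1 = << (0, sb_one ns_words) >>.
  apply: sexp_mon1; apply: (@ns_vf_mon1 (fun i => i.+1%:Z) (fun i => i%:Z)).
    exact: even_pos1.
  exact: odd_pos1.
have e3 : sexp ((2 : K) *: term (Psi 0) (Gen_L 0)) mon1 = << (0, sb_one ns_words) >>.
  apply: sexp_mon1; rewrite seriesZ term_mon1 ?scaler0 //; exact: Psi01.
have e23 : smul (sexp (ns_pos (even_pos Psi) (odd_pos Psi)))
    (sexp ((2 : K) *: term (Psi 0) (Gen_L 0))) mon1 = << (0, sb_one ns_words) >>.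
  rewrite smul_mon1; exact: etrans (f_equal2 (@cmul K ns_words) e2 e3) one2.
rewrite /expPsi smul_mon1; exact: etrans (f_equal2 (@cmul K ns_words) e1 e23) one2.
Qed.

Lemma Gam1 : Gam mon1 = 0.
Proof. by case: hGam. Qed.

Lemma Gam_d_mon1 : Gam_d mon1 = 0.
Proof. by apply: term_mon1; apply: Gam1. Qed.

Lemma expGam_wdeg m c : c \in msupp (expGam m) -> wdeg c.2 = 0.
Proof.
have M' (a b d : int * ns_words) : sb_mul a.2 b.2 = Some d.2 -> d.1 = a.1 + b.1 ->
    wdeg d.2 = wdeg a.2 + wdeg b.2 by move=> [/= <-] _; rewrite wdegM.
have H : @homog K ns_words int (fun=> 0) (fun c => wdeg c.2) setT 0 expGam.
  apply: (sexp_homog zero_wtM M' (S := setT)) => //; first exact: wdeg1.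
  rewrite -[X in homog _ _ _ X](addr0 (0 : int)).
  apply: (smul_homog zero_wtM M' (S := setT)) => //.
    by apply: lift_homog => m' _ l _; rewrite wdeg1.
  have E : (0 : int) = wdeg (fmu Gen_d) by rewrite wdegU.
  rewrite {2}E.
  by apply: (@scst_homog K ns_words int (fun=> 0) (fun c => wdeg c.2) setT 0
    (fmu Gen_d)).
by move=> /(H m I); rewrite add0r.
Qed.

(** The degree of words is left out of this grading; in exp(Gamma d) it is 0 by [expGam_wdeg]. *)
Definition dlk (c : int * ns_words) : int * int := (c.1, 0).

Lemma dlkM (a b c : int * ns_words) :
  sb_mul a.2 b.2 = Some c.2 -> c.1 = a.1 + b.1 -> dlk c = dlk a + dlk b.
Proof. by move=> _ E; rewrite /dlk E; congr (_, _); rewrite addr0. Qed.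

Local Notation khomog := (@homog K ns_words _ bwt dlk S (0, 0)).

Lemma Gam_d_homog : khomog Gam_d.
Proof.
have -> : (0, 0) = (0, 0) + (0, 0) :> (int * int)%type by [].
apply: (smul_homog bwtM dlkM (@lt_div (mdg M))).
  by apply: lift_homog => m Sm l; apply: IH.
by apply: (@scst_homog K ns_words _ bwt dlk S 0 (fmu Gen_d)); apply: bwt1.
Qed.

Lemma expGam_homog : khomog expGam.
Proof.
by apply: (sexp_homog bwtM dlkM (@lt_div (mdg M))) => //; [exact: bwt1|exact: Gam_d_homog].
Qed.

Lemma mcoeff_Gam_d c : (Gam_d M)@_c = if c.2 == (fmu Gen_d : ns_words) then (Gam M)@_c.1 else 0.
Proof.
rewrite /Gam_d /term smul_eq1; last first.
  move=> [m1 m2] fm nm; right; rewrite /scst; case: eqP => //= E.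
  by case: nm; move: fm; rewrite E => /factors_inj1 ->.
have E : scst K 0 (fmu Gen_d : ns_words) mon1 = << 1 *g (0, (fmu Gen_d : ns_words)) >>.
  rewrite /scst eqxx; exact: erefl.
rewrite E (mcoeff_cmul_lift nsone_mul).
by rewrite subr0 mulr1.
Qed.

Lemma cmul_nsone (f : nc) : cmul f << (0, sb_one ns_words) >> = f.
Proof.
rewrite cmul_mono [RHS]monalgE; apply: eq_bigr => -[l w] _.
by rewrite /umul /= mulm1 addr0 mulr1.
Qed.

(** At the wrong exponent [k], the powers of Gamma d from the second on contribute nothing at [M]:
    their proper factorisations are homogeneous by induction. Only the linear term remains. *)
Lemma mcoeff_expGam c : c.1 = k ->
  (expGam M)@_c = if c.2 == (fmu Gen_d : ns_words) then (Gam M)@_k else 0.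
Proof.
move=> ck; have bad' : bwt M + dlk c != (0, 0) + (0, 0) by rewrite /dlk ck.
have rG : raising (smul Gam_d) by apply: smul_raising; apply: Gam_d_mon1.
have sh : khomog (sone K ns_words).
  by apply: (@scst_homog K ns_words _ bwt dlk S 0 (sb_one ns_words)); apply: bwt1.
have H g : khomog g -> (smul Gam_d g M)@_c = (cmul (Gam_d M) (g mon1))@_c.
  by move=> hg; apply: (mcoeff_smul_lin bwtM dlkM Gam_d_mon1 Gam_d_homog hg bad').
have HG g : khomog g -> khomog (smul Gam_d g).
  by move=> hg; apply: (smul_homog bwtM dlkM (@lt_div (mdg M)) Gam_d_homog hg).
rewrite /expGam /sexp mcoeff_opexp //; last first.
  move=> i; rewrite iterS H; last by apply: iter_homog.
  rewrite iterS (raising_mon1 _ rG).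
  have -> : cmul (Gam_d M) 0 = 0 by apply: cmulf0.
  exact: mcoeff0.
rewrite (H _ sh) nsone_mon1 cmul_nsone mcoeff_Gam_d ck.
rewrite {1}/sone /scst; case: eqP => [M1|_]; first by move: M0; rewrite M1 mdg1.
by rewrite mcoeff0 add0r.
Qed.

Lemma Lam_expGam : Lam k (expGam M) = 24 * (Gam M)@_k.
Proof.
(* The linear term found in [mcoeff_expGam]. The remainder has no coefficient at t^k, so [Lam k]
   kills it. *)
pose h : nc := << (Gam M)@_k *g (k, (fmu Gen_d : ns_words)) >>.
have -> : expGam M = (expGam M - h) + h by rewrite subrK.
rewrite raddfD /= [X in X + _]Lam_eq0; last first.
  move=> c; rewrite -mcoeff_neq0 mcoeffB => + ck; rewrite mcoeff_expGam //.
  rewrite /h mcoeffU; case: c ck => c1 c2 /= ->; rewrite xpair_eqE eqxx /=.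
  by rewrite [_ == c2]eq_sym; case: (c2 =P _) => _ /=;
    rewrite ?mulr1n ?subrr ?mulr0n ?subr0 ?eqxx.
by rewrite add0r /Lam mmapU /= eqxx lam_d mulrC.
Qed.

Lemma Lam_insP p : Lam k (insP p expGam M) = if p == 0 then Lam k (expGam M) else 0.
Proof.
have [->|np] := eqVneq p 0; last first.
  apply: Lam_eq0 => c /msupp_insP [b bm ->] _.
  rewrite -[X in lam X]mul1m; apply: lam_P; rewrite (expGam_wdeg bm) => /eqP.
  by rewrite eq_sym oppr_eq0 (negPf np).
have -> : insP 0 expGam M = cmul << (1 : K) *g (0, (fmu (Gen_P 0) : ns_words)) >> (expGam M).
  rewrite /insP smulE (fsum_eq1 (factors_l1 M)); last first.
    move=> [m1 m2] fm nm; apply: pterm_l0; rewrite /scst; case: eqP => //= E.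
    by case: nm; move: fm; rewrite E => /factors_inj2 ->.
  rewrite pterm_l1; congr (cmul _ _); rewrite /scst eqxx oppr0.
  apply/malgP => c; rewrite mcoeff_ctwist mcoeffU.
  case: eqP => [<-|_]; last by rewrite mulr0.
  by rewrite (_ : sb_parity _ = false) ?andbF ?expr0 ?mul1r //= fmU.
rewrite (cmulE msuppU_le (fsubset_refl _)) big_seq_fset1 mcoeffUU raddf_sum /=.
rewrite [RHS]mmapE big_seq [RHS]big_seq; apply: eq_bigr => b bm.
rewrite /umul /= mul1r add0r /Lam mmapU /=.
by rewrite lam_P0.
Qed.

(** In a factorisation other than (1, M) both factors are homogeneous. A word surviving [lam] then
    has wdeg wb = 0, hence p = 0 and wdeg wa = 0, and its exponent of t would be the right one for
    [M], against [bad]. *)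
Lemma Lam_around p : Lam k (smul expPsi (insP p expGam) M) = if p == 0 then 24 * (Gam M)@_k else 0.
Proof.
rewrite -Lam_expGam -Lam_insP smulE.
have Hrest m : factors M m -> m <> (mon1, M) -> Lam k (pterm expPsi (insP p expGam) m) = 0.
  move=> fm nm; apply: Lam_eq0 => c.
  case/msupp_pterm => -[ka wa] [d [am /msupp_insP [[kb wb] bm ->] [<-] /= E1]] ck.
  have mM : (mdg m.2 < mdg M)%N.
    have := mdg_factors fm; have [/(factors_r0 fm)//|] := eqVneq (mdg m.2) (mdg M).
    by lia.
  have Ha := expPsi_homog I am; have Hb := expGam_homog mM bm.
  have b0 : wdeg wb = 0 := expGam_wdeg bm.
  apply/eqP; apply: contraNT bad => nz.
  have d0 : wdeg (mmul (wa : {fmonom ns_gen})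
    (mmul (fmu (Gen_P p)) (wb : {fmonom ns_gen})) : ns_words) = 0.
    by apply/eqP; apply: contraNT nz => /lam_deg /eqP.
  have dp : wdeg wb = - p.
    by apply: contrapT => nb; case/eqP: nz; apply: lam_P.
  move: d0; rewrite !wdegM wdegU /= add0r => d0.
  rewrite (bwtM fm); move: Ha Hb E1 ck; rewrite /dlw /dlk /=.
  case: (bwt m.1) => x1 y1; case: (bwt m.2) => x2 y2.
  rewrite mul0r => -[A1 A2] [B1 B2] E1 ck.
  by apply/eqP; congr (_, _) => /=; lia.
have fin : finite_set (factors M `&` [set m | pterm expPsi (insP p expGam) m != 0]).
  exact/finite_setIl/finite_factors.
apply: etrans (raddf_fsum1 (h := Lam k) fin (factors_l1 M) Hrest) _.
rewrite pterm_l1 expPsi_mon1; congr (Lam k).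
have -> : ctwist (mon_parity M) << (0, sb_one ns_words) >> =
    << (1 : K) *g (0, sb_one ns_words) >>.
  apply/malgP => c; rewrite mcoeff_ctwist mcoeffU.
  case: eqP => [<-|_]; last by rewrite mulr0.
  by rewrite (_ : sb_parity _ = false) ?andbF ?expr0 ?mul1r //= fm1.
apply/malgP => -[l w]; rewrite -{1}[l]add0r.
rewrite (@mcoeff_mono_cmul _ ns_words 1 (0, sb_one ns_words) _ l w w) ?mul1r ?nsone_mul //.
by move=> w'; rewrite nsone_mul => -[].
Qed.

(** The sum over all integers p would be 0 by convention on an infinite support, and its term p = 0
    would be lost. For fixed [M] finitely many exponents ka, kb occur, and ka - p + kb = k
    determines p. *)
Lemma around_fin :
  finite_set [set p : int | tcoef k (smul expPsi (insP p expGam) M) != 0].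
Proof.
apply: (@sub_finite_set _ _ (\bigcup_(m in factors M)
  ((fun q : (int * ns_words) * (int * ns_words) => q.1.1 + q.2.1 - k) @`
    ([set` msupp (expPsi m.1)] `*` [set` msupp (expGam m.2)])))); last first.
  apply: bigcup_finite => [|m _]; first exact: finite_factors.
  by apply: finite_image; apply: finite_setX; apply: finite_fset.
move=> p /=; apply: contra_neqP => H; rewrite /tcoef big_seq_cond big1 // => c.
case/andP => /msupp_around [m [[ka wa] [[kb wb] [fm am bm E _]]]] /eqP ck; case: H.
by exists m => //; exists ((ka, wa), (kb, wb)) => //=; rewrite -ck E /=; ring.
Qed.

Lemma rho_around :
  rho (around_tL0 expPsi expGam M k) topv (inr false) = 24 * (Gam M)@_k.
Proof.
pose h : ns_free K -> K := mmap idfun (fun a : {fmonom ns_gen} => wact a topv (inr false)).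
have fin : finite_set (setT `&`
    [set p : int | (tcoef k (smul expPsi (insP p expGam) M) : ns_free K) != 0]).
  by apply: sub_finite_set around_fin => p [].
have H0 p : setT p -> p <> 0 -> h (tcoef k (smul expPsi (insP p expGam) M)) = 0.
  move=> _ np; apply: etrans (LamE _ _) _; rewrite Lam_around.
  by case: eqP.
apply: etrans (raddf_fsum1 (h := h) (i0 := 0) fin I H0) _.
apply: etrans (LamE _ _) _.
by rewrite Lam_around eqxx.
Qed.

(** Applying the matrix coefficient between w and u to the defining equation gives 0 on the left and
    24 times the coefficient on the right. *)
Lemma Gamma_step : (Gam M)@_k = 0.
Proof.
case: hGam => _ _ /(_ M k) /(rho_UP_eq topv (inr false)) H.
have := etrans (esym (around_AB bad)) (etrans H rho_around).
have n24 : (24 : K) != 0.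
  have -> : (24 : K) = 2 * 2 * 2 * 3 by ring.
  by rewrite !mulf_neq0.
by move/esym/eqP; rewrite mulf_eq0 (negPf n24) => /eqP.
Qed.

End Step.

Lemma Gamma_homog Psi (Gam : scalars K) :
  is_Psi Psi -> is_Gamma Psi Gam -> scal_homog setT (0, - 0) Gam.
Proof.
move=> hPsi hGam; rewrite oppr0.
suff H n : scal_homog [set m | (mdg m < n)%N] (0, 0) Gam.
  by move=> m _; apply: (H (mdg m).+1) => /=.
elim: n => [|n IH] m //= mn k km.
have [m0|m0] := posnP (mdg m).
  by move: km; rewrite (mdg_eq0 m0); case: hGam => -> _ _; rewrite msupp0 inE.
apply/eqP; apply: contraTT km => bad; rewrite -mcoeff_eq0; apply/eqP.
apply: (Gamma_step hPsi hGam m0 _ bad).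
by move=> m' /= m'm; apply: IH => /=; lia.
Qed.

End Gamma.

Theorem proposition3p40 (R : realType) (Psi : int -> scalars R[i])
    (Gamma : scalars R[i]) (hPsi : is_Psi Psi) (hGamma : is_Gamma Psi Gamma) :
  (forall p : int, polynomial_power_series (Psi p)) /\
  polynomial_power_series Gamma.
Proof.
have n2 : (2 : R[i]) != 0 by rewrite pnatr_eq0.
have n3 : (3 : R[i]) != 0 by rewrite pnatr_eq0.
split=> [p|].
  exact: scal_homog_polynomial (Psi_homog n2 hPsi (p := p)).
exact: scal_homog_polynomial (Gamma_homog n2 n3 hPsi hGamma).
Qed.
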